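(* Assume (A1)–(A6) and $\alpha-\beta-1<\frac{4\theta}{\beta+1}$. Let $u(\cdot,\rho)$ be the regular solution of $L(u)+e^{f(u)}=0$, $u(0)=\rho$, $u'(0)=0$, and let $u^*(r)=u^*_{\lambda^*}(r(\lambda^* )^{-1/\theta})$, where $(u^*_{\lambda^*},\lambda^* )$ is the singular solution of Theorem 1.1 (so $u^*$ is a singular solution of $L(u)+e^{f(u)}=0$ near $0$). Then for every $\delta>0$, $$\lim_{\rho\to+\infty}\mathscr L_{(0,\delta)}\big(u(\cdot,\rho)-u^*\big)=+\infty,$$ where $\mathscr L_{(a,b)}(h)$ denotes the number of zeros of $h$ in $(a,b)$.
   Context: $L(u)(r)=r^{-\gamma}(r^{\alpha}|u'|^{\beta}u')'$, $\theta=\gamma+2+\beta-\alpha$, $g=f^{-1}$; ''$O(g''(t))$'' means bounded by $C|g''(t)|$ for large $t$, $o(t)$ any $h$ with $h(t)/t\to0$. (A1) $f\in C^4([0,\infty))$, $f'>0$, $f\to+\infty$. (A2) $g''(t)\to0$ and $f(g(t)+\varepsilon(t))/t\to1$ for every $\varepsilon(t)=O(g''(t))$. (A3) $g'(t)/g'(t+h(t))\to1$ for every $h=o(t)$. (A4) $\frac{g''(t)}{g'(t)}\ln g'(t)\to0$. (A5)(a) $g'''(\ln g')^n=O(g'')$, $n=0,1,2$, $g^{(4)}\ln g'=O(g'')$; (b) $\sup_{s\ge t}|g''(s)|=O(g''(t))$, $g''(t+h(t))=O(g''(t))$ for $h=o(t)$. (A6) $\alpha>\beta+1$, $\beta\ge0$,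 $\theta>0$. Theorem 1.1 provides $\lambda^*>0$ and a singular solution $u^*_{\lambda^*}$ of $L(u)+\lambda^*e^{f(u)}=0$ on $(0,1)$, $u^*_{\lambda^*}(1)=0$, $u^*_{\lambda^*}(r)\to+\infty$ as $r\to0^+$, with $u^*_{\lambda^*}(r)=g(Z(r))+O(g''(\ln r^{-\theta}))$, $Z(r)=\ln\{\theta^{\beta+1}(\alpha-\beta-1)\}-\ln\lambda^*-\theta\ln r+(\beta+1)\ln\{g'(\tau)+(\beta+1)g''(\tau)\ln g'(\tau)\}$, $\tau=\ln\frac{\beta+1}{\lambda^*r^\theta}$. *)

(* Defs.v *)
From HB Require Import structures.
From mathcomp Require Import all_boot all_order all_algebra.
From mathcomp Require Import all_classical all_reals all_analysis.
Set Implicit Arguments. Unset Strict Implicit. Unset Printing Implicit Defensive.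
Import Order.TTheory GRing.Theory Num.Theory.
Import numFieldNormedType.Exports.
Local Open Scope classical_set_scope.
Local Open Scope ring_scope.

Section Defs.
Variable R : realType.

Definition bigO_infty (h k : R -> R) : Prop :=
  exists C : R, \forall t \near +oo, `|h t| <= C * `|k t|.

Definition littleo_id (h : R -> R) : Prop :=
  h t / t @[t --> +oo] --> (0 : R).

Definition C4_nonneg (f : R -> R) : Prop :=
  (forall k, (k < 4)%N -> forall x, 0 < x -> derivable ((derive1n k f)) x 1) /\
  (forall k, (k <= 4)%N ->
     (forall x, 0 < x -> {for x, continuous ((derive1n k f))}) /\
     cvg ((derive1n k f) x @[x --> 0^'+])) /\
  f x @[x --> 0^'+] --> f 0.

Definition A1 (f : R -> R) : Prop :=
  C4_nonneg f /\
  (forall x, 0 < x -> 0 < (derive1 f) x) /\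
  (exists l : R, 0 < l /\ (derive1 f) x @[x --> 0^'+] --> l) /\
  f x @[x --> +oo] --> +oo.

Definition is_inverse_of (g f : R -> R) : Prop :=
  (forall x, 0 <= x -> g (f x) = x) /\ (forall t, f 0 <= t -> f (g t) = t).

Definition A2 (f g : R -> R) : Prop :=
  (derive1n 2 g) t @[t --> +oo] --> (0 : R) /\
  forall eps : R -> R, bigO_infty eps ((derive1n 2 g)) ->
    f (g t + eps t) / t @[t --> +oo] --> (1 : R).

Definition A3 (g : R -> R) : Prop :=
  forall h : R -> R, littleo_id h ->
    (derive1 g) t / (derive1 g) (t + h t) @[t --> +oo] --> (1 : R).

Definition A4 (g : R -> R) : Prop :=
  (derive1n 2 g) t / (derive1 g) t * ln ((derive1 g) t) @[t --> +oo] --> (0 : R).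

Definition A5 (g : R -> R) : Prop :=
  ((forall n, (n <= 2)%N ->
      bigO_infty (fun t => (derive1n 3 g) t * (ln ((derive1 g) t)) ^+ n) ((derive1n 2 g))) /\
   bigO_infty (fun t => (derive1n 4 g) t * ln ((derive1 g) t)) ((derive1n 2 g))) /\
  ((exists C : R, \forall t \near +oo,
       forall s, t <= s -> `|(derive1n 2 g) s| <= C * `|(derive1n 2 g) t|) /\
   (forall h : R -> R, littleo_id h ->
       bigO_infty (fun t => (derive1n 2 g) (t + h t)) ((derive1n 2 g)))).

Definition theta (alpha beta gamma : R) : R := gamma + 2 + beta - alpha.

Definition A6 (alpha beta gamma : R) : Prop :=
  beta + 1 < alpha /\ 0 <= beta /\ 0 < theta alpha beta gamma.

Definition flux (alpha beta : R) (u : R -> R) (r : R) : R :=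
  r `^ alpha * `|(derive1 u) r| `^ beta * (derive1 u) r.

Definition solves_on (alpha beta gamma lam : R) (f u : R -> R) (D : set R)
  : Prop :=
  forall r, D r ->
    derivable u r 1 /\ derivable (flux alpha beta u) r 1 /\
    r `^ (- gamma) * (derive1 (flux alpha beta u)) r + lam * expR (f (u r)) = 0.

(* u is the regular solution of L(u) + e^{f(u)} = 0, u(0) = rho, u'(0) = 0,
   on its maximal interval [0, Rmax) of existence (where u > 0, f being
   defined on [0,oo) only): either Rmax = +oo or u -> 0 at Rmax. *)
Definition regular_solution (alpha beta gamma : R) (f : R -> R) (rho : R)
  (u : R -> R) (Rmax : \bar R) : Prop :=
  (0%:E < Rmax)%E /\
  u 0 = rho /\
  (u h - u 0) / h @[h --> 0^'+] --> (0 : R) /\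
  solves_on alpha beta gamma 1 f u [set r | 0 < r /\ (r%:E < Rmax)%E] /\
  (forall r, 0 <= r -> (r%:E < Rmax)%E -> 0 < u r) /\
  (Rmax = +oo%E \/ exists Rf : R, Rmax = Rf%:E /\ u r @[r --> Rf^'-] --> (0 : R)).

Definition Zfun (alpha beta gamma lam : R) (g : R -> R) (r : R) : R :=
  let th := theta alpha beta gamma in
  let tau := ln ((beta + 1) / (lam * r `^ th)) in
  ln (th `^ (beta + 1) * (alpha - beta - 1)) - ln lam - th * ln r
  + (beta + 1) * ln ((derive1 g) tau + (beta + 1) * (derive1n 2 g) tau * ln ((derive1 g) tau)).

Definition thm11_singular (alpha beta gamma : R) (f g : R -> R) (lam : R)
  (U : R -> R) : Prop :=
  0 < lam /\
  solves_on alpha beta gamma lam f U [set r | 0 < r < 1] /\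
  U 1 = 0 /\ U r @[r --> 1^'-] --> (0 : R) /\
  U r @[r --> 0^'+] --> +oo /\
  (exists C : R, \forall r \near 0^'+,
     `|U r - g (Zfun alpha beta gamma lam g r)|
       <= C * `|(derive1n 2 g) (ln (r `^ (- theta alpha beta gamma)))|).

Definition nzeros_ge (h : R -> R) (D : set R) (N : nat) : Prop :=
  exists s : seq R, uniq s /\ size s = N /\ forall r, r \in s -> D r /\ h r = 0.

End Defs.

(* Main.v *)
Require Import Defs.
From HB Require Import structures.
From mathcomp Require Import all_boot all_order all_algebra.
From mathcomp Require Import all_classical all_reals all_analysis.
From mathcomp Require Import ring lra.
Import Order.TTheory GRing.Theory Num.Theory.
Import numFieldNormedType.Exports.
Local Open Scope classical_set_scope.
Local Open Scope ring_scope.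
Set Implicit Arguments. Unset Strict Implicit. Unset Printing Implicit Defensive.

(* Put x = ln r and rescale a solution of height rho = g(t), t = f(rho), by
     u(e^(x+l)) = rho + g'(t) w(x),   e^(theta l) = g'(t)^(beta+1) e^(-t).
   Since g' varies slowly, f(g(t) + g'(t) w) = t + w + o(1), so the rescaled
   equation tends to L(w) + e^w = 0, while the rescaled singular solution tends
   to w* = ys - theta x with ys = ln(theta^(beta+1) (alpha-beta-1)). With
   z = w - w*, a = ln(- w' / theta), b = beta + 1 and k = alpha - beta - 1, the
   limit equation is the autonomous system
     z' = - theta (e^a - 1),   a' = (k / b) (e^(z - b a) - 1),
   whose equilibrium (0, 0) is a focus exactly when k < 4 theta / b.
   If z kept a constant sign, a slope m (m = a / z when z > 0 and
   m = (e^(b a) - 1) / (e^z - 1) when z < 0) would satisfy a Riccati inequality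
   m' >= A m^2 - B m + C with B^2 < 4 A C and blow up; so z changes sign
   infinitely often. The passage to the limit is made along an arbitrary
   ultrafilter finer than rho -> +oo, which only needs local bounds and no
   uniqueness for the limit problem: a property that holds along all these
   ultrafilters holds for all large rho. *)

(** * Real derivatives and mean values *)

Section real_derivatives.
Context {R : realType}.
Implicit Types (f g df : R -> R) (a b c d x y p q : R).

Lemma der_cst c x : is_derive x 1 (fun=> c) (0 : R).
Proof. exact: is_derive_cst. Qed.

Lemma der_id x : is_derive x 1 (fun y : R => y) (1 : R).
Proof. exact: is_derive_id. Qed.

Lemma derD f g x a b : is_derive x 1 f a -> is_derive x 1 g b ->
  is_derive x 1 (fun y => f y + g y) (a + b).
Proof. by move=> fa gb; exact: (is_deriveD fa gb). Qed.

Lemma derN f x a : is_derive x 1 f a -> is_derive x 1 (fun y => - f y) (- a).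
Proof. by move=> fa; exact: (is_deriveN fa). Qed.

Lemma derM f g x a b : is_derive x 1 f a -> is_derive x 1 g b ->
  is_derive x 1 (fun y => f y * g y) (f x * b + g x * a).
Proof. by move=> fa gb; exact: (is_deriveM fa gb). Qed.

Lemma der_comp f g x a b : is_derive (g x) 1 f a -> is_derive x 1 g b ->
  is_derive x 1 (fun y => f (g y)) (a * b).
Proof. by move=> fa gb; exact: (is_derive1_comp fa gb). Qed.

Lemma der_expR f x a : is_derive x 1 f a ->
  is_derive x 1 (fun y => expR (f y)) (expR (f x) * a).
Proof. by apply: der_comp; exact: is_derive_expR. Qed.

Lemma der_ln f x a : 0 < f x -> is_derive x 1 f a ->
  is_derive x 1 (fun y => ln (f y)) ((f x)^-1 * a).
Proof. by move=> fx0; apply: der_comp; exact: is_derive1_ln. Qed.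

Lemma der_inv f x a : f x != 0 -> is_derive x 1 f a ->
  is_derive x 1 (fun y => (f y)^-1) (- (f x ^- 2) * a).
Proof.
by move=> fx0 fa; apply: is_derive_eq (is_deriveV fx0 fa) _.
Qed.

End real_derivatives.

Ltac der := eapply is_derive_eq;
  [ repeat first [ eassumption | exact: der_cst | exact: der_id | eapply derD
                 | eapply derN | eapply derM | eapply der_expR
                 | eapply der_ln | eapply der_inv ] | rewrite /= ].

Section mean_value.
Context {R : realType}.
Implicit Types (f df : R -> R) (a b c x y p q : R).

Lemma mean_value f df p q : p <= q ->
  (forall x, p <= x <= q -> is_derive x 1 f (df x)) ->
  exists2 c, p <= c <= q & f q - f p = df c * (q - p).
Proof.
rewrite le_eqVlt => /predU1P[<-|pq] dfE.
  by exists p; rewrite ?lexx// !subrr mulr0.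
have [||c] := MVT pq (f := f) (df := df).
- by move=> x; rewrite in_itv/= => /andP[px xq]; apply: dfE; rewrite !ltW.
- apply: derivable_within_continuous => x; rewrite in_itv/= => xpq.
  by have [] := dfE _ xpq.
- by rewrite in_itv/= => /andP[pc cq] ?; exists c => //; rewrite !ltW.
Qed.

Lemma ger0_der_le f df p q : p <= q ->
  (forall x, p <= x <= q -> is_derive x 1 f (df x)) ->
  (forall x, p <= x <= q -> 0 <= df x) -> f p <= f q.
Proof.
move=> pq dfE df0; have [c cpq E] := mean_value pq dfE.
by rewrite -subr_ge0 E mulr_ge0 ?df0// subr_ge0.
Qed.

Lemma gtr0_der_lt f df p q : p < q ->
  (forall x, p <= x <= q -> is_derive x 1 f (df x)) ->
  (forall x, p <= x <= q -> 0 < df x) -> f p < f q.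
Proof.
move=> pq dfE df0; have [c cpq E] := mean_value (ltW pq) dfE.
by rewrite -subr_gt0 E mulr_gt0 ?df0// subr_gt0.
Qed.

Lemma der_ge_le f df c p q : p <= q ->
  (forall x, p <= x <= q -> is_derive x 1 f (df x)) ->
  (forall x, p <= x <= q -> c <= df x) -> f p + c * (q - p) <= f q.
Proof.
move=> pq dfE dfc; have [x xpq E] := mean_value pq dfE.
by rewrite -lerBrDl E ler_wpM2r ?dfc// subr_ge0.
Qed.

(* [B ^ 2 < 4 A C] makes the quadratic at least [c (1 + m ^ 2)] with [c > 0], so
   [atan m] would grow linearly. *)
Lemma riccati_blowup (m dm : R -> R) (A B C x0 : R) :
  0 < A -> 0 < C -> B ^+ 2 < 4 * A * C ->
  (forall x, x0 <= x -> is_derive x 1 m (dm x)) ->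
  (forall x, x0 <= x -> A * m x ^+ 2 - B * m x + C <= dm x) -> False.
Proof.
move=> A0 C0 disc dmE dm_ge.
(* This choice gives 4 (A - c) (C - c) = B ^ 2 + 4 c ^ 2, so A y ^ 2 - B y + C - c (1 + y ^ 2) has
   no real root. *)
pose c := (4 * A * C - B ^+ 2) / (4 * (A + C)).
have c0 : 0 < c by rewrite divr_gt0//; lra.
have cE : 4 * c * (A + C) = 4 * A * C - B ^+ 2 by rewrite /c; field; lra.
have cA : c < A.
  by rewrite -(ltr_pM2r (_ : 0 < 4 * (A + C)))//; nra.
have quad y : c * (1 + y ^+ 2) <= A * y ^+ 2 - B * y + C.
  rewrite -subr_ge0 -(pmulr_rge0 _ (_ : 0 < 4 * (A - c)))//; last lra.
  have -> : 4 * (A - c) * (A * y ^+ 2 - B * y + C - c * (1 + y ^+ 2)) =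
     (2 * (A - c) * y - B) ^+ 2 + 4 * c ^+ 2
     + (4 * A * C - 4 * c * (A + C) - B ^+ 2) by ring.
  rewrite cE; have := sqr_ge0 (2 * (A - c) * y - B); have := sqr_ge0 c; lra.
(* Over a length pi / c the function [atan m] would gain at least pi, while its values lie strictly
   between - pi / 2 and pi / 2. *)
pose q := x0 + pi / c.
have pi0 : 0 < pi :> R by exact: pi_gt0.
have x0q : x0 <= q by rewrite lerDl divr_ge0// ltW.
suff : atan (m x0) + c * (q - x0) <= atan (m q).
  have -> : c * (q - x0) = pi by rewrite /q addrAC subrr add0r; field; lra.
  have := atan_gtNpi2 (m x0); have := atan_ltpi2 (m q); lra.
apply: (@der_ge_le (fun x => atan (m x)) (fun x => (1 + m x ^+ 2)^-1 * dm x)) => //.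
  move=> x /andP[x0x _].
  exact: (der_comp (is_derive1_atan (m x)) (dmE _ x0x)).
move=> x /andP[x0x _].
have P0 : 0 < 1 + m x ^+ 2 by have := sqr_ge0 (m x); lra.
rewrite mulrC ler_pdivlMr//; exact: le_trans (quad _) (dm_ge _ x0x).
Qed.

End mean_value.

Ltac nz := repeat (apply/andP; split);
  first [ by [] | by apply: lt0r_neq0 | by apply: ltr0_neq0
        | by apply: lt0r_neq0; lra | by apply: ltr0_neq0; lra ].

(** * Oscillation of the limit system *)

Section oscillation.
Context {R : realType}.
Variables (th k b : R).
Hypotheses (th0 : 0 < th) (k0 : 0 < k) (b1 : 1 <= b) (disc : b * k < 4 * th).
Variables (z a : R -> R).
Hypothesis dz : forall x : R, is_derive x 1 z (- th * (expR (a x) - 1)).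
Hypothesis da :
  forall x : R, is_derive x 1 a (k / b * (expR (z x - b * a x) - 1)).

Let b0 : 0 < b. Proof. exact: lt_le_trans b1. Qed.
Let kb0 : 0 < k / b. Proof. exact: divr_gt0. Qed.

Let pos : [/\ 0 < th, 0 < k, 1 <= b, 0 < b & b * k < 4 * th]. Proof. by []. Qed.

(** By e ^ y >= 1 + y, the derivative of [a] is bounded below by its linearisation at the
    equilibrium. *)
Lemma a_slope_ge x : k / b * z x - k * a x <= k / b * (expR (z x - b * a x) - 1).
Proof.
have [hth hk hb1 hb0 hdisc] := pos.
have -> : k / b * z x - k * a x = k / b * (z x - b * a x).
  by rewrite mulrBr mulrA divfK ?gt_eqF.
by rewrite ler_pM2l// lerBrDl expR_ge1Dx.
Qed.

(** Suppose z stays nonnegative. Then a e ^ (k x) is nondecreasing, and a becomes positive: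
    otherwise z would not decrease and a would grow linearly. From there on a > 0, so z decreases
    strictly and is positive, and a / z satisfies a Riccati inequality. *)
Lemma z_returns_neg x1 : 0 < z x1 -> exists2 x, x1 < x & z x < 0.
Proof.
have [hth hk hb1 hb0 hdisc] := pos.
move=> z1; apply: contrapT => nex.
have nz x : x1 <= x -> 0 <= z x.
  rewrite le_eqVlt => /predU1P[<-|x1x]; first exact: ltW.
  by rewrite leNgt; apply/negP => zx; apply: nex; exists x.
have w_le x y : x1 <= x -> x <= y ->
    a x * expR (k * x) <= a y * expR (k * y).
  move=> x1x xy.
  have D (t : R) : is_derive t 1 (fun t => a t * expR (k * t))
      (expR (k * t) * (k / b * (expR (z t - b * a t) - 1) + k * a t)).
    by have ? := da t; der; ring.
  apply: (ger0_der_le xy (fun t _ => D t)) => t /andP[xt _].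
  rewrite mulr_ge0 ?expR_ge0//; have := a_slope_ge t.
  have : 0 <= k / b * z t by rewrite mulr_ge0 ?nz ?(le_trans x1x)// ltW.
  by lra.
have [x2 x12 a2] : exists2 x2, x1 <= x2 & 0 < a x2.
  apply: contrapT => nea.
  have a_le x : x1 <= x -> a x <= 0.
    by move=> x1x; rewrite leNgt; apply/negP => ax; apply: nea; exists x.
  have z_ge x : x1 <= x -> z x1 <= z x.
    move=> x1x; apply: (ger0_der_le x1x (fun t _ => dz t)) => t /andP[x1t _].
    by rewrite mulNr -mulrN mulr_ge0 ?(ltW th0)// opprB subr_ge0 expR_le1 a_le.
  pose c := k / b * z x1.
  have c0 : 0 < c by rewrite mulr_gt0.
  (* By this time growth at rate [c] would have lifted [a] to at least 1. *)
  pose x := x1 + (`|a x1| + 1) / c.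
  have x1x : x1 <= x by rewrite lerDl divr_ge0 ?ltW// ltr_wpDl.
  have : a x1 + c * (x - x1) <= a x.
    apply: (der_ge_le x1x (fun t _ => da t)) => t /andP[x1t _].
    apply: le_trans (a_slope_ge t).
    have : c <= k / b * z t by rewrite ler_pM2l// z_ge.
    have : k * a t <= 0 by rewrite pmulr_rle0 ?a_le.
    by lra.
  have -> : c * (x - x1) = `|a x1| + 1 by rewrite /x addrAC subrr add0r; field; nz.
  by have := a_le _ x1x; have := ler_norm (- a x1); rewrite normrN; lra.
have a_pos x : x2 <= x -> 0 < a x.
  move=> x2x; have := w_le _ _ x12 x2x.
  by move=> /(lt_le_trans (mulr_gt0 a2 (expR_gt0 _))); rewrite pmulr_lgt0// expR_gt0.
have z_pos x : x2 <= x -> 0 < z x.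
  move=> x2x; apply: (@le_lt_trans _ _ (z (x + 1))); first by apply: nz; lra.
  rewrite -ltrN2.
  have D (t : R) : is_derive t 1 (fun t => - z t) (th * (expR (a t) - 1)).
    by have ? := dz t; der; ring.
  apply: (gtr0_der_lt _ (fun t _ => D t)); first by rewrite ltrDl.
  by move=> t /andP[xt _]; rewrite mulr_gt0// subr_gt0 expR_gt1 a_pos// (le_trans x2x).
(* The coefficients come from e ^ a - 1 >= a and [a_slope_ge]; the condition k ^ 2 < 4 th k / b is
   [disc] multiplied by k / b. *)
apply: (@riccati_blowup _ (fun x => a x * (z x)^-1)
  (fun x => a x * (- (z x ^- 2) * (- th * (expR (a x) - 1)))
            + (z x)^-1 * (k / b * (expR (z x - b * a x) - 1))) th k (k / b) x2) => //.
- rewrite -subr_gt0.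
  have -> : 4 * th * (k / b) - k ^+ 2 = k / b * (4 * th - b * k).
    by field; nz.
  by rewrite mulr_gt0// subr_gt0.
- move=> x x2x; have zx := z_pos _ x2x.
  by have ? := dz x; have ? := da x; apply: derM => //; apply: der_inv => //; rewrite gt_eqF.
- move=> x x2x /=; have zx := z_pos _ x2x; have ax := a_pos _ x2x.
  have z2 : 0 < z x ^+ 2 by rewrite exprn_gt0.
  set e1 := expR (a x); set e2 := expR _.
  rewrite -(ler_pM2l z2).
  have -> : z x ^+ 2 * (th * (a x / z x) ^+ 2 - k * (a x / z x) + k / b) =
    th * a x ^+ 2 - k * a x * z x + k / b * z x ^+ 2 by field; nz.
  have -> : z x ^+ 2 * (a x * (- (z x ^- 2) * (- th * (e1 - 1))) +
     (z x)^-1 * (k / b * (e2 - 1))) = th * a x * (e1 - 1) + z x * (k / b * (e2 - 1)).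
    by field; nz.
  have h1 : th * a x * a x <= th * a x * (e1 - 1).
    by rewrite ler_pM2l ?mulr_gt0// lerBrDl expR_ge1Dx.
  have h2 : z x * (k / b * z x - k * a x) <= z x * (k / b * (e2 - 1)).
    by rewrite ler_pM2l// a_slope_ge.
  by lra.
Qed.

(** With y = e ^ x - 1 this is Bernoulli's inequality (1 + y) ^ b >= 1 + b y. The difference of the
    two sides is at least (b - 1) (1 - e ^ x (1 - x)), and e ^ x (1 - x) <= 1. *)
Lemma expR_bernoulli x : b * (expR x - 1) <= expR (b * x) - 1.
Proof.
have [hth hk hb1 hb0 hdisc] := pos.
have -> : b * x = x + (b - 1) * x by ring.
rewrite expRD.
have h1 : expR x * (1 + (b - 1) * x) <= expR x * expR ((b - 1) * x).
  by rewrite ler_pM2l ?expR_gt0// expR_ge1Dx.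
have h2 : expR x * (1 - x) <= 1.
  rewrite -[leRHS](expRxMexpNx_1 x) ler_pM2l ?expR_gt0//.
  exact: expR_ge1Dx.
have : 0 <= (b - 1) * (1 - expR x * (1 - x)) by rewrite mulr_ge0//; lra.
by lra.
Qed.

(** Replaces [a] as the unknown where z is negative: the equation for [K] is affine in [K], and
    Bernoulli's inequality bounds the derivative of z below by a multiple of [K]. *)
Let K x := expR (b * a x) - 1.

Let dK (x : R) : is_derive x 1 K (k * (expR (z x) - 1 - K x)).
Proof.
have [hth hk hb1 hb0 hdisc] := pos.
have ? := da x; rewrite /K; der.
have -> : expR (z x) = expR (b * a x) * expR (z x - b * a x).
  by rewrite -expRD; congr expR; ring.
by field; nz.
Qed.

Let dz_ge x : - (th / b) * K x <= - th * (expR (a x) - 1).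
Proof.
have [hth hk hb1 hb0 hdisc] := pos.
rewrite !mulNr lerN2 -(ler_pM2l b0).
have -> : b * (th / b * K x) = th * K x by field; nz.
have -> : b * (th * (expR (a x) - 1)) = th * (b * (expR (a x) - 1)) by ring.
by rewrite ler_pM2l// expR_bernoulli.
Qed.

(** If z stayed below - d, the affine equation would drive [K] below a negative constant, and z
    would then increase at least linearly. *)
Lemma z_not_below d x1 : 0 < d -> exists2 x, x1 <= x & - d < z x.
Proof.
have [hth hk hb1 hb0 hdisc] := pos.
move=> d0; apply: contrapT => nex.
have nz x : x1 <= x -> z x <= - d.
  by move=> x1x; rewrite leNgt; apply/negP => zx; apply: nex; exists x.
pose c := 1 - expR (- d).
have c0 : 0 < c by rewrite subr_gt0 expR_lt1 oppr_lt0.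
have wle x : x1 <= x -> (K x + c) * expR (k * x) <= (K x1 + c) * expR (k * x1).
  move=> x1x; rewrite -lerN2.
  have D (t : R) : is_derive t 1 (fun t => - ((K t + c) * expR (k * t)))
      (expR (k * t) * (k * (- (expR (z t) - 1) - c))).
    by have ? := dK t; der; ring.
  apply: (ger0_der_le x1x (fun t _ => D t)) => t /andP[x1t _].
  rewrite mulr_ge0 ?expR_ge0// mulr_ge0 ?(ltW k0)//.
  have : expR (z t) <= expR (- d) by rewrite ler_expR nz.
  by rewrite /c; lra.
(* Chosen so that (c / 2) (1 + y) = c / 2 + |K x1 + c|. Since e ^ y >= 1 + y, after a time y / k the
   decaying bound on K + c is at most c / 2. *)
pose y := 2 * `|K x1 + c| / c.
have y0 : 0 <= y by rewrite divr_ge0 ?mulr_ge0 ?(ltW c0).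
have x12 : x1 <= x1 + y / k by rewrite lerDl divr_ge0// ltW.
have K_le x : x1 + y / k <= x -> K x <= - (c / 2).
  move=> x2x; have x1x : x1 <= x by exact: le_trans x2x.
  suff : K x + c <= c / 2 by lra.
  have := wle x x1x; rewrite -ler_pdivlMr ?expR_gt0// => /le_trans; apply.
  rewrite -mulrA -expRN -expRD; have -> : k * x1 + - (k * x) = - (k * (x - x1)) by ring.
  rewrite expRN ler_pdivrMr ?expR_gt0//.
  have h : y <= k * (x - x1) by rewrite mulrC -ler_pdivrMr// lerBrDl.
  have h2 : 1 + y <= expR (k * (x - x1)).
    by apply: le_trans (expR_ge1Dx _); rewrite lerD2l.
  apply: (@le_trans _ _ (c / 2 * (1 + y))); last by rewrite ler_pM2l ?divr_gt0.
  have -> : c / 2 * (1 + y) = c / 2 + `|K x1 + c| by rewrite /y; field; nz.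
  by have := ler_norm (K x1 + c); lra.
set x2 := x1 + y / k in x12 K_le.
pose s := th / b * (c / 2).
have s0 : 0 < s by rewrite mulr_gt0 ?divr_gt0.
pose x := x2 + (`|z x2| + 1) / s.
have x2x : x2 <= x by rewrite lerDl divr_ge0 ?ltW// ltr_wpDl.
have : z x2 + s * (x - x2) <= z x.
  apply: (der_ge_le x2x (fun t _ => dz t)) => t /andP[x2t _].
  apply: le_trans (dz_ge t); rewrite mulNr -mulrN ler_pM2l ?divr_gt0//.
  by have := K_le _ x2t; lra.
have -> : s * (x - x2) = `|z x2| + 1 by rewrite /x addrAC subrr add0r; field; nz.
have := nz x (le_trans x12 x2x); have := ler_norm (- z x2); rewrite normrN; lra.
Qed.

(** Suppose z stays nonpositive. Then K e ^ (k x) is nonincreasing, and K becomes negative: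
    otherwise z would not increase and would stay below z x1 < 0, against [z_not_below]. From there
    on K < 0, so z increases strictly and is negative, and K / (e ^ z - 1) satisfies a Riccati
    inequality. *)
Lemma z_returns_pos x1 : z x1 < 0 -> exists2 x, x1 < x & 0 < z x.
Proof.
have [hth hk hb1 hb0 hdisc] := pos.
move=> z1; apply: contrapT => nex.
have nz x : x1 <= x -> z x <= 0.
  rewrite le_eqVlt => /predU1P[<-|x1x]; first exact: ltW.
  by rewrite leNgt; apply/negP => zx; apply: nex; exists x.
have w_le x y : x1 <= x -> x <= y ->
    K y * expR (k * y) <= K x * expR (k * x).
  move=> x1x xy; rewrite -lerN2.
  have D (t : R) : is_derive t 1 (fun t => - (K t * expR (k * t)))
      (expR (k * t) * (k * (1 - expR (z t)))).
    by have ? := dK t; der; ring.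
  apply: (ger0_der_le xy (fun t _ => D t)) => t /andP[xt _].
  rewrite mulr_ge0 ?expR_ge0// mulr_ge0 ?(ltW k0)// subr_ge0 expR_le1 nz//.
  exact: le_trans xt.
have [x2 x12 K2] : exists2 x2, x1 <= x2 & K x2 < 0.
  apply: contrapT => nek.
  have K_ge x : x1 <= x -> 0 <= K x.
    by move=> x1x; rewrite leNgt; apply/negP => ax; apply: nek; exists x.
  have z_le x : x1 <= x -> z x <= z x1.
    move=> x1x; rewrite -lerN2.
    have D (t : R) : is_derive t 1 (fun t => - z t) (th * (expR (a t) - 1)).
      by have ? := dz t; der; ring.
    apply: (ger0_der_le x1x (fun t _ => D t)) => t /andP[x1t _].
    rewrite mulr_ge0 ?(ltW th0)// subr_ge0.
    have := K_ge _ x1t; rewrite subr_ge0 leNgt expR_lt1 -leNgt pmulr_rge0// => at0.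
    by rewrite leNgt expR_lt1 -leNgt.
  have [|x x1x] := @z_not_below (- z x1) x1; first by rewrite oppr_gt0.
  by rewrite opprK ltNge z_le.
have K_neg x : x2 <= x -> K x < 0.
  move=> x2x; have := w_le _ _ x12 x2x.
  by move=> /le_lt_trans/(_ (_ : _ < 0)); rewrite !pmulr_llt0 ?expR_gt0//; apply.
have a_neg x : x2 <= x -> a x < 0.
  by move=> /K_neg; rewrite subr_lt0 expR_lt1 pmulr_rlt0.
have dz_pos x : x2 <= x -> 0 < - th * (expR (a x) - 1).
  by move=> /a_neg ax; rewrite mulNr -mulrN mulr_gt0// opprB subr_gt0 expR_lt1.
have z_incr x y : x2 <= x -> x < y -> z x < z y.
  move=> x2x xy; apply: (gtr0_der_lt xy (fun t _ => dz t)) => t /andP[xt _].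
  by rewrite dz_pos// (le_trans x2x).
have z_neg x : x2 <= x -> z x < 0.
  move=> x2x; apply: (@lt_le_trans _ _ (z (x + 1))); last by apply: nz; lra.
  by apply: z_incr => //; rewrite ltrDl.
(* The midpoint of b k / (4 th) and 1. The quadratic Riccati coefficient loses the factor e ^ z < 1;
   once e ^ z >= q the condition b k < 4 th q still holds. [z_not_below] and monotonicity give e ^ z
   >= q from some point on. *)
pose q := (1 + b * k / (4 * th)) / 2.
have q1 : b * k / (4 * th) < 1 by rewrite ltr_pdivrMr ?mul1r// mulr_gt0.
have q0 : 0 < b * k / (4 * th) by rewrite divr_gt0 ?mulr_gt0.
have lnq : 0 < - ln q by rewrite oppr_gt0 ln_lt0// /q; apply/andP; split; lra.
have [x3 x23 z3] := @z_not_below (- ln q) x2 lnq.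
have Ez x : x3 <= x -> q <= expR (z x).
  rewrite le_eqVlt => x3x; rewrite -[leLHS]lnK ?posrE; last by rewrite /q; lra.
  rewrite ler_expR; move: z3; rewrite opprK => z3.
  by move: x3x => /predU1P[<-|/(z_incr _ _ x23) /(lt_trans z3)]; apply: ltW.
apply: (@riccati_blowup _ (fun x => K x * (expR (z x) - 1)^-1)
  (fun x => K x * (- ((expR (z x) - 1) ^- 2) * (expR (z x) * (- th * (expR (a x) - 1))))
     + (expR (z x) - 1)^-1 * (k * (expR (z x) - 1 - K x))) (th * q / b) k k x3) => //.
- by rewrite divr_gt0 ?mulr_gt0//; rewrite /q; lra.
- have -> : 4 * (th * q / b) * k = k / b * (4 * th * q) by field; nz.
  have -> : k ^+ 2 = k / b * (b * k) by field; nz.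
  rewrite ltr_pM2l//; have -> : 4 * th * q = (4 * th + b * k) / 2 by rewrite /q; field; nz.
  lra.
- move=> x x3x; have zx := z_neg _ (le_trans x23 x3x).
  have E0 : expR (z x) - 1 != 0 by rewrite lt_eqF// subr_lt0 expR_lt1.
  have ? := dz x; have ? := dK x; apply: derM => //; apply: der_inv => //.
  by der; ring.
- move=> x x3x /=; have x2x := le_trans x23 x3x; have zx := z_neg _ x2x.
  have Kx := K_neg _ x2x.
  have := Ez _ x3x; have := dz_ge x; have := dz_pos _ x2x.
  set dzx := - th * _ => dzp dzg.
  have : expR (z x) - 1 < 0 by rewrite subr_lt0 expR_lt1.
  set E := expR (z x) - 1; have -> : expR (z x) = E + 1 by rewrite /E; ring.
  move=> E0 qE; have E2 : 0 < E ^+ 2 by rewrite exprn_even_gt0//= lt_eqF.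
  rewrite -(ler_pM2l E2).
  have -> : E ^+ 2 * (th * q / b * (K x / E) ^+ 2 - k * (K x / E) + k) =
    th * q / b * K x ^+ 2 - k * K x * E + k * E ^+ 2 by field; nz.
  have -> : E ^+ 2 * (K x * (- (E ^- 2) * ((E + 1) * dzx)) + E^-1 * (k * (E - K x))) =
    - K x * ((E + 1) * dzx) + k * E * (E - K x) by field; nz.
  have : - K x * (q * (- (th / b) * K x)) <= - K x * ((E + 1) * dzx).
    rewrite ler_pM2l ?oppr_gt0//; apply: (@le_trans _ _ (q * dzx)).
      by rewrite ler_pM2l//; rewrite /q; lra.
    by rewrite ler_pM2r.
  have -> : - K x * (q * (- (th / b) * K x)) = th * q / b * K x ^+ 2 by ring.
  lra.
Qed.

End oscillation.

(** * Limits along ultrafilters *)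

Lemma sign_changes {R : realType} (z : R -> R) (x0 : R) :
  (forall x, z x < 0 -> exists2 y, x < y & 0 < z y) ->
  (forall x, 0 < z x -> exists2 y, x < y & z y < 0) ->
  z x0 < 0 ->
  exists s : nat -> R, forall i, s i < s i.+1 /\ z (s i) * z (s i.+1) < 0.
Proof.
move=> up down z0.
(* On the subtype of points where z does not vanish, a later point of opposite sign always exists,
   so a choice function can be iterated. *)
have next (p : {x | z x != 0}) :
    exists q : {x | z x != 0}, val p < val q /\ z (val p) * z (val q) < 0.
  case: p => x /= /[dup] zx; rewrite neq_lt => /orP[/[dup] zn /up|/[dup] zn /down] [y xy zy].
    have zy0 : z y != 0 by rewrite gt_eqF.
    by exists (exist _ y zy0); rewrite /= nmulr_rlt0.
  have zy0 : z y != 0 by rewrite lt_eqF.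
  by exists (exist _ y zy0); rewrite /= pmulr_rlt0.
have [F FP] := choice next.
have z00 : z x0 != 0 by rewrite lt_eqF.
by exists (fun i => val (iter i F (exist _ x0 z00))) => i; exact: FP.
Qed.

(** The intermediate value theorem gives a zero between consecutive points; these zeros are distinct
    because they lie in disjoint open intervals. *)
Lemma zeros_of_sign_changes {R : realType} (h : R -> R) (s : nat -> R) (N : nat) :
  (forall i, s i < s i.+1) ->
  (forall i, (i < N)%N -> h (s i) * h (s i.+1) < 0) ->
  (forall x, s 0%N <= x <= s N -> {for x, continuous h}) ->
  nzeros_ge h [set x | s 0%N < x < s N] N.
Proof.
move=> s_lt; have s_le : {homo s : i j / (i <= j)%N >-> i <= j}.
  by apply: homo_leq => //; [exact: le_trans | move=> i; exact: ltW].
elim: N => [|N IH] hs hc; first by exists [::].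
have [||t [ut [st tP]]] := IH.
- by move=> i iN; apply: hs; exact: ltnW.
- by move=> x /andP[sx xs]; apply: hc; rewrite sx (le_trans xs)// s_le.
have hNN := hs N (ltnSn N).
have [c cN hc0] : exists2 c, s N < c < s N.+1 & h c = 0.
  have [||c] := @IVT _ h (s N) (s N.+1) 0 (ltW (s_lt N)).
  - apply: continuous_in_subspaceT => x /[!inE] /= /[!in_itv] /= /andP[sx xs].
    by apply: hc; rewrite xs (le_trans _ sx)// s_le.
  - rewrite ge_min le_max; case: (ltgtP (h (s N)) 0) hNN => [h0|h0|->].
    + by rewrite nmulr_rlt0// => h1; rewrite (ltW h1) ?orbT.
    + by rewrite pmulr_rlt0// => h1; rewrite (ltW h1) ?orbT.
    + by rewrite mul0r ltxx.
  rewrite in_itv/= => /andP[sc cs] hc0; exists c => //.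
  (* The strict sign of the product excludes zeros at the endpoints, so the new zero exceeds all the
     earlier ones. *)
  have hn0 i : h (s i) = 0 -> i = N \/ i = N.+1 -> False.
    by move=> h0 [] iE; move: hNN; rewrite -iE h0 ?mulr0 ?mul0r ltxx.
  rewrite !lt_neqAle sc cs !andbT; apply/andP; split; apply/eqP => cE.
    by apply: (hn0 N); [rewrite cE|left].
  by apply: (hn0 N.+1); [rewrite -cE|right].
move: cN => /andP[sc cs].
exists (c :: t); split; last split.
- rewrite /= ut andbT; apply/negP => /tP[/andP[_ cN] _].
  by move: (lt_trans sc cN); rewrite ltxx.
- by rewrite /= st.
- move=> r; rewrite inE => /predU1P[->|/tP[/andP[sr rs] hr]].
    by split => //=; rewrite cs (le_lt_trans _ sc)// s_le.
  by split => //=; rewrite sr (lt_trans rs).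
Qed.

Section compactness.
Context {R : realType} {T : Type}.

(** Compactness of the segment gives a cluster point; an ultrafilter contains each preimage or its
    complement, so it converges to its cluster points. *)
Lemma ultra_bounded_cvg (G : set_system T) (F : T -> R) (M : R) :
  UltraFilter G -> (\forall t \near G, `|F t| <= M) ->
  exists l : R, F t @[t --> G] --> l.
Proof.
move=> UG FM.
have : compact (`[- M, M]%classic : set R) by exact: segment_compact.
case/(_ (F @ G) _ _) => [|l [_ Fl]].
- by apply: filterS FM => t; rewrite ler_norml/= in_itv/=; exact.
- exists l => B Bl; have [//|nB] := in_ultra_setVsetC (F @^-1` B) UG.
  by have [r [/= nBr Br]] := Fl (~` B) B nB Bl.
Qed.

Lemma is_derive_remainder (f : R -> R) (x c : R) :
  (forall e, 0 < e -> exists2 d, 0 < d &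
     forall y, `|y - x| <= d -> `|f y - f x - (y - x) * c| <= e * `|y - x|) ->
  is_derive x 1 f c.
Proof.
move=> H.
have L : h^-1 *: ((f \o shift x) (h *: (1 : R)) - f x) @[h --> 0^'] --> c.
  apply/cvgrPdist_le => e e0; have [d d0 Hd] := H e e0.
  near=> h.
  have h0 : h != 0 by near: h; exact: nbhs_dnbhs_neq.
  have hd : `|h| <= d.
    near: h; apply: cvg_within; exists d => //= y /=; rewrite sub0r normrN.
    exact: ltW.
  rewrite /= [h *: _]mulr1; have := Hd (h + x); rewrite addrK => /(_ hd).
  set D := f _ - f x => DE.
  have -> : c - h^-1 *: D = - (h^-1 * (D - h * c)).
    by rewrite /GRing.scale/=; field.
  by rewrite normrN normrM normfV mulrC ler_pdivrMr// normr_gt0.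
by apply: DeriveDef; [apply: cvgP L | exact: cvg_lim L].
Unshelve. all: by end_near. Qed.

(** Only equicontinuity of the derivatives at [x] is used: the mean value theorem bounds the
    first-order remainder of [F t], and this bound passes to the limit for each fixed [y]. *)
Lemma is_derive_limit (G : set_system T) (F F' : T -> R -> R) (f : R -> R)
    (x c : R) : ProperFilter G ->
  (forall e, 0 < e -> exists2 d, 0 < d & \forall t \near G,
     forall y, `|y - x| <= d ->
       is_derive y 1 (F t) (F' t y) /\ `|F' t y - F' t x| <= e) ->
  (forall y, F t y @[t --> G] --> f y) ->
  F' t x @[t --> G] --> c ->
  is_derive x 1 f c.
Proof.
move=> PG equi Ff F'c; apply: is_derive_remainder => e e0.
have [d d0 Gd] := equi e e0; exists d => // y yx.
have L : `|F t y - F t x - (y - x) * F' t x| @[t --> G]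
    --> `|f y - f x - (y - x) * c|.
  by apply: cvg_norm; apply: cvgB; [exact: cvgB|apply: cvgM => //; exact: cvg_cst].
apply: (cvgr_to_le L); apply: filterS Gd => t Ht.
have seg s : Num.min x y <= s <= Num.max x y -> `|s - x| <= d.
  move=> sxy; apply: le_trans yx; case: (leP x y) sxy => xy /andP[xs sy].
    by rewrite !ger0_norm ?subr_ge0// lerD2r.
  by rewrite !ler0_norm ?subr_le0 ?(ltW xy)// !opprB lerD2l lerN2.
have [||s sxy E] := @mean_value _ (F t) (F' t) (Num.min x y) (Num.max x y).
- by rewrite ge_min !le_max !lexx.
- by move=> s /seg /Ht[].
have {}E : F t y - F t x = F' t s * (y - x).
  by move: E; case: (leP x y) => // _ E; rewrite -opprB E -mulrN opprB.
rewrite E [(y - x) * _]mulrC -mulrBl normrM ler_wpM2r//.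
by have [] := Ht _ (seg _ sxy).
Qed.

End compactness.

(** * Passage to the limit in the rescaled system *)

Section limit_system.
Context {R : realType}.

Lemma expR_lipschitz (L p q : R) : `|p| <= L -> `|q| <= L ->
  `|expR p - expR q| <= expR L * `|p - q|.
Proof.
wlog qp : p q / q <= p => [H|].
  by case: (leP q p) => [|/ltW] pq pL qL; [|rewrite distrC (distrC p)]; exact: H.
move=> pL qL; have [c /andP[qc cp] ->] := mean_value qp (fun x _ => is_derive_expR x).
rewrite normrM ler_wpM2r// ger0_norm ?expR_ge0// ler_expR (le_trans cp)//.
exact: le_trans (ler_norm _) pL.
Qed.

Lemma der_bound_lipschitz (f df : R -> R) (K X x y : R) : `|x| <= X -> `|y| <= X ->
  (forall s : R, `|s| <= X -> is_derive s 1 f (df s) /\ `|df s| <= K) ->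
  `|f y - f x| <= K * `|y - x|.
Proof.
wlog xy : x y / x <= y => [H|].
  by case: (leP x y) => [|/ltW] pq xX yX; [|rewrite distrC (distrC y)]; exact: H.
move=> xX yX H.
have HX s : x <= s <= y -> `|s| <= X.
  move: xX yX; rewrite !ler_norml => /andP[xX _] /andP[_ yX] /andP[xs sy].
  by rewrite (le_trans xX)//= (le_trans sy).
have [s sP ->] := mean_value xy (fun s sxy => (H s (HX s sxy)).1).
by rewrite normrM ler_wpM2r//; have [] := H s (HX s sP).
Qed.

(** Local bounds give pointwise limits along the ultrafilter. They also bound the derivatives, so
    the right-hand sides are locally Lipschitz uniformly in [t] up to small errors, which is the
    equicontinuity that [is_derive_limit] asks for. *)
Lemma limit_system {T : Type} (G : set_system T) (th k b : R) (Z A : T -> R -> R) :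
  UltraFilter G -> 0 < th -> 0 < k -> 1 <= b ->
  (forall X, exists M, \forall t \near G, forall x : R, `|x| <= X ->
     `|Z t x| <= M /\ `|A t x| <= M) ->
  (forall X, \forall t \near G, forall x : R, `|x| <= X ->
     is_derive x 1 (Z t) (- th * (expR (A t x) - 1))) ->
  (forall X eta : R, 0 < eta -> \forall t \near G, forall x : R, `|x| <= X ->
     exists2 d : R, is_derive x 1 (A t) d &
       `|d - k / b * (expR (Z t x - b * A t x) - 1)| <= eta) ->
  exists z a : R -> R,
    [/\ forall x, Z t x @[t --> G] --> z x,
        forall x : R, is_derive x 1 z (- th * (expR (a x) - 1)) &
        forall x : R, is_derive x 1 a (k / b * (expR (z x - b * a x) - 1))].
Proof.
move=> UG th0 k0 b1 bnd dZ dA.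
have b0 : 0 < b by exact: lt_le_trans b1.
have kb0 : 0 < k / b by exact: divr_gt0.
have Zc x : exists l : R, Z t x @[t --> G] --> l.
  have [M GM] := bnd `|x|; apply: (@ultra_bounded_cvg _ _ _ _ M).
  by apply: filterS GM => t /(_ x (lexx _)) [].
have Ac x : exists l : R, A t x @[t --> G] --> l.
  have [M GM] := bnd `|x|; apply: (@ultra_bounded_cvg _ _ _ _ M).
  by apply: filterS GM => t /(_ x (lexx _)) [].
have [z Zz] := choice Zc; have [a Aa] := choice Ac.
have expc (F : T -> R) (l : R) : F t @[t --> G] --> l ->
    expR (F t) @[t --> G] --> expR l.
  by move=> Fl; apply: continuous_cvg Fl; exact: continuous_expR.
(* The hypothesis gives derivatives of [A t] only pointwise and depending on the tolerance; [DA]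
   names them by one function. *)
have [DA DAP] : exists DA : T -> R -> R, forall t (x : R) d,
    is_derive x 1 (A t) d -> DA t x = d.
  exists (fun t x => derive1 (A t) x) => t x d D.
  by rewrite derive1E; exact: derive_val.
pose V t x := k / b * (expR (Z t x - b * A t x) - 1).
(* common Lipschitz constant for both components near [x] *)
have unif x : exists Q, 0 < Q /\ forall eta : R, 0 < eta -> eta <= 1 ->
    \forall t \near G, forall y : R, `|y - x| <= 1 ->
    [/\ is_derive y 1 (A t) (DA t y), `|DA t y - V t y| <= eta,
        `|V t y - V t x| <= Q * `|y - x| &
        `|- th * (expR (A t y) - 1) - - th * (expR (A t x) - 1)| <= Q * `|y - x|].
  have [M GM] := bnd (`|x| + 1).
  (* [L] bounds both exponents, [A] and [Z - b A]; [K] below bounds the derivatives of [Z] and [A],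
     its last 1 covering the error [eta]. *)
  pose L := `|M| + b * `|M|; pose E := expR L.
  have E1 : 1 <= E.
    by rewrite -[leLHS]expR0 ler_expR addr_ge0// mulr_ge0// ltW.
  have E0 : 0 < E by exact: expR_gt0.
  pose K := th * (E + 1) + (k / b * (E + 1) + 1).
  have thE : 0 < th * (E + 1) by rewrite mulr_gt0// addr_gt0.
  have kbE : 0 < k / b * (E + 1) by rewrite mulr_gt0// addr_gt0.
  have K0 : 0 < K by rewrite !addr_gt0.
  exists (th * (E * K) + k / b * (E * (K + b * K))); split.
    have KbK : 0 < K + b * K by exact: addr_gt0 K0 (mulr_gt0 b0 K0).
    exact: addr_gt0 (mulr_gt0 th0 (mulr_gt0 E0 K0)) (mulr_gt0 kb0 (mulr_gt0 E0 KbK)).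
  move=> eta eta0 eta1.
  have := dA (`|x| + 1) eta eta0; have := dZ (`|x| + 1).
  apply: filterS3 GM => t tM tZ tA.
  have near_x y : `|y - x| <= 1 -> `|y| <= `|x| + 1.
    by move=> yx; rewrite -[y](subrK x) addrC (le_trans (ler_normD _ _))// lerD2l.
  have ML y : `|y| <= `|x| + 1 -> `|A t y| <= L /\ `|Z t y - b * A t y| <= L.
    move=> /tM[Zy Ay]; have MM := ler_norm M; split.
      by rewrite (le_trans Ay)// (le_trans MM)// lerDl mulr_ge0// ltW.
    rewrite (le_trans (ler_normB _ _))// lerD ?(le_trans Zy)//.
    by rewrite normrM (gtr0_norm b0) ler_pM2l// (le_trans Ay).
  have exp1 p : `|p| <= L -> `|expR p - 1| <= E + 1.
    move=> pL; rewrite (le_trans (ler_normB _ _))// normr1 lerD2r.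
    by rewrite ger0_norm ?expR_ge0// ler_expR (le_trans (ler_norm _)).
  have AD (y : R) : `|y| <= `|x| + 1 ->
      is_derive y 1 (A t) (DA t y) /\ `|DA t y - V t y| <= eta.
    by move=> /tA[d Dd dV]; rewrite (DAP _ _ _ Dd).
  have lipZ y : `|y - x| <= 1 -> `|Z t y - Z t x| <= K * `|y - x|.
    move=> yx; apply: (@der_bound_lipschitz _ (fun s => - th * (expR (A t s) - 1)) _
      (`|x| + 1) _ _ _ (near_x y yx)).
      by rewrite lerDl.
    move=> s sX; split; first exact: tZ.
    rewrite normrM normrN (gtr0_norm th0).
    have := exp1 _ (ML s sX).1; rewrite -(ler_pM2l th0) => /le_trans; apply.
    by rewrite /K lerDl ltW// addr_gt0.
  have lipA y : `|y - x| <= 1 -> `|A t y - A t x| <= K * `|y - x|.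
    move=> yx; apply: (@der_bound_lipschitz _ (DA t) _ (`|x| + 1) _ _ _ (near_x y yx)).
      by rewrite lerDl.
    move=> s sX; have [As1 As2] := AD s sX; split => //.
    rewrite -[DA t s](subrK (V t s)) (le_trans (ler_normD _ _))//.
    have : `|V t s| <= k / b * (E + 1).
      by rewrite normrM (gtr0_norm kb0) ler_pM2l// exp1//; have [] := ML s sX.
    rewrite /K; lra.
  move=> y yx; have yX := near_x y yx; have [A1 A2] := AD y yX; split => //.
  - have xX : `|x| <= `|x| + 1 by rewrite lerDl.
    rewrite /V -mulrBr normrM (gtr0_norm kb0) mulrDl.
    apply: ler_wpDl; first by rewrite !mulr_ge0 ?(ltW th0) ?(ltW E0) ?(ltW K0).
    rewrite -(mulrA (k / b) _ `|y - x|) ler_pM2l// opprB addrA subrK.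
    apply: le_trans (expR_lipschitz (ML y yX).2 (ML x xX).2) _.
    rewrite -mulrA ler_pM2l// opprB.
    have -> : Z t y - b * A t y + (b * A t x - Z t x) =
      (Z t y - Z t x) - b * (A t y - A t x) by ring.
    rewrite (le_trans (ler_normB _ _))// mulrDl lerD ?lipZ//.
    by rewrite normrM (gtr0_norm b0) -mulrA ler_pM2l// lipA.
  - have xX : `|x| <= `|x| + 1 by rewrite lerDl.
    rewrite -mulrBr normrM normrN (gtr0_norm th0) mulrDl.
    apply: ler_wpDr.
      rewrite mulr_ge0// mulr_ge0 ?(ltW kb0)// mulr_ge0 ?(ltW E0)//.
      by rewrite addr_ge0 ?mulr_ge0 ?(ltW b0) ?(ltW K0).
    rewrite -mulrA ler_pM2l// opprB addrA subrK.
    apply: le_trans (expR_lipschitz (ML y yX).1 (ML x xX).1) _.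
    by rewrite -mulrA ler_pM2l// lipA.
exists z, a; split => // x.
- have [Q [Q0 HQ]] := unif x.
  apply: (@is_derive_limit _ _ G Z (fun t x => - th * (expR (A t x) - 1))) => //.
    move=> e e0; exists (Num.min 1 (e / Q)); first by rewrite lt_min ltr01 divr_gt0.
    have := dZ (`|x| + 1); have := HQ 1 ltr01 (lexx _).
    apply: filterS2 => t HtQ HtZ y; rewrite le_min => /andP[y1 ye]; split.
      apply: HtZ; rewrite -[y](subrK x) addrC (le_trans (ler_normD _ _))//.
      by rewrite lerD2l.
    have [_ _ _ /le_trans] := HtQ y y1; apply.
    by rewrite mulrC -ler_pdivlMr.
  by apply: cvgM; [exact: cvg_cst|apply: cvgB; [exact: expc|exact: cvg_cst]].
- have [Q [Q0 HQ]] := unif x.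
  apply: (@is_derive_limit _ _ G A DA) => //.
    (* Two thirds of [e] pay for replacing [DA] by [V] at [x] and [y], one third for the variation
       of [V]. *)
    move=> e e0; exists (Num.min 1 (e / 3 / Q)).
      by rewrite lt_min ltr01 !divr_gt0.
    have := HQ (Num.min 1 (e / 3)) _ _; rewrite lt_min ltr01 divr_gt0// ge_min lexx => /(_ isT isT).
    apply: filterS => t HtQ y; rewrite le_min => /andP[y1 ye].
    have [Ay dy Vy _] := HtQ y y1; split => //.
    have [|_ dx _ _] := HtQ x; first by rewrite subrr normr0.
    move: dx dy; rewrite !le_min => /andP[_ dx] /andP[_ dy].
    have {}Vy : `|V t y - V t x| <= e / 3.
      by rewrite (le_trans Vy)// mulrC -ler_pdivlMr.
    have -> : DA t y - DA t x = (DA t y - V t y) + (V t y - V t x) - (DA t x - V t x) by ring.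
    rewrite (le_trans (ler_normB _ _))// (_ : e = e / 3 + e / 3 + e / 3); last by field.
    by rewrite lerD// (le_trans (ler_normD _ _))// lerD.
  have Vc : V t x @[t --> G] --> k / b * (expR (z x - b * a x) - 1).
    apply: cvgM; [exact: cvg_cst|apply: cvgB; [apply: expc|exact: cvg_cst]].
    by apply: cvgB => //; apply: cvgM => //; exact: cvg_cst.
  rewrite -[X in _ --> X]addr0.
  rewrite (_ : DA ^~ x = (fun t => V t x + (DA t x - V t x))); last first.
    by apply/funext => t; ring.
  apply: cvgD => //; apply/cvgr0Pnorm_le => e e0.
  have := HQ (Num.min 1 e) _ _; rewrite lt_min ltr01 e0 ge_min lexx => /(_ isT isT).
  apply: filterS => t /(_ x)[|_]; first by rewrite subrr normr0.
  by rewrite le_min => /andP[].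
Qed.

End limit_system.

(** * Asymptotics of the inverse nonlinearity *)

Section nonlinearity.
Context {R : realType}.
Variables f g : R -> R.
Hypotheses (f1 : A1 f) (fg : is_inverse_of g f).

Lemma A1_is_derive (x : R) : 0 < x -> is_derive x 1 f (derive1 f x).
Proof.
move=> x0; have [[fD _] _] := f1.
by apply: DeriveDef; [exact: (fD 0%N)|rewrite derive1E].
Qed.

Lemma A1_is_derive2 (x : R) : 0 < x -> is_derive x 1 (derive1 f) (derive1n 2 f x).
Proof.
move=> x0; have [[fD _] _] := f1.
by apply: DeriveDef; [exact: (fD 1%N)|rewrite /= derive1E].
Qed.

Lemma A1_lt (x y : R) : 0 < x -> x < y -> f x < f y.
Proof.
move=> x0 xy; have [_ [f'0 _]] := f1.
apply: (gtr0_der_lt xy (df := derive1 f)) => s /andP[xs _].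
  by apply: A1_is_derive; exact: lt_le_trans xs.
by apply: f'0; exact: lt_le_trans xs.
Qed.

Lemma A1_le (x y : R) : 0 < x -> x <= y -> f x <= f y.
Proof. by move=> x0; rewrite le_eqVlt => /predU1P[->//|/(A1_lt x0)/ltW]. Qed.

Lemma A1_continuous (x : R) : 0 < x -> {for x, continuous f}.
Proof.
move=> /A1_is_derive[D _]; exact/differentiable_continuous/derivable1_diffP.
Qed.

(** The intermediate value theorem on [1, oo) writes [t] as a value of [f]. The threshold [f 1]
    keeps [g t] in the open half-line where [f] is differentiable. *)
Lemma inverse_large (t : R) : f 1 < t -> 0 < g t /\ f (g t) = t.
Proof.
move=> f1t; have [_ [_ [_ fy]]] := f1.
have [X [_ HX]] := cvgry_ge fy t.
pose y := Num.max 2 (X + 1).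
have y1 : 1 <= y by rewrite le_max; apply/orP; left; lra.
have fyt : t <= f y by apply: HX; rewrite lt_max; apply/orP; right; lra.
have [||x] := @IVT _ f 1 y t y1.
- apply: derivable_within_continuous => x; rewrite in_itv/= => /andP[x1 _].
  by have [] := A1_is_derive (lt_le_trans ltr01 x1).
- by rewrite ge_min le_max (ltW f1t) fyt orbT.
rewrite in_itv/= => /andP[x1 _] fxt.
have x0 : 0 < x := lt_le_trans ltr01 x1.
by rewrite -fxt fg.1 ?ltW.
Qed.

Let g_der (t : R) : f 1 < t -> is_derive t 1 g (derive1 f (g t))^-1.
Proof.
move=> f1t; have [gt0 fgt] := inverse_large f1t.
rewrite -{1}fgt; apply: is_derive_inverse.
- near=> y; apply: fg.1; near: y.
  by near=> y; apply: ltW; near: y; exact: lt_nbhsr.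
- near=> y; apply: A1_continuous; near: y; exact: lt_nbhsr.
- exact: A1_is_derive.
- by rewrite gt_eqF//; have [_ [f'0 _]] := f1; exact: f'0.
Unshelve. all: by end_near. Qed.

Lemma inverse_derive1E (t : R) : f 1 < t -> derive1 g t = (derive1 f (g t))^-1.
Proof. by move=> /g_der D; rewrite derive1E; exact: derive_val. Qed.

Lemma inverse_is_derive (t : R) : f 1 < t -> is_derive t 1 g (derive1 g t).
Proof. by move=> f1t; rewrite inverse_derive1E//; exact: g_der. Qed.

Lemma inverse_derive1_gt0 (t : R) : f 1 < t -> 0 < derive1 g t.
Proof.
move=> f1t; rewrite inverse_derive1E// invr_gt0.
by have [_ [f'0 _]] := f1; apply: f'0; have [] := inverse_large f1t.
Qed.

Lemma inverse_is_derive2 (t : R) : f 1 < t ->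
  is_derive t 1 (derive1 g) (derive1n 2 g t).
Proof.
move=> f1t; have [gt0 _] := inverse_large f1t.
have f'0 : derive1 f (g t) != 0.
  by rewrite gt_eqF//; have [_ [f'0 _]] := f1; exact: f'0.
have D := @der_inv _ (fun y => derive1 f (g y)) _ _ f'0
  (der_comp (A1_is_derive2 gt0) (inverse_is_derive f1t)).
suff E : is_derive t 1 (derive1 g)
    (- (derive1 f (g t) ^- 2) * (derive1n 2 f (g t) * derive1 g t)).
  by rewrite /= derive1E; apply: DeriveDef; have [] := E.
apply: near_eq_is_derive D; near=> s; rewrite inverse_derive1E//.
by near: s; exact: lt_nbhsr.
Unshelve. all: by end_near. Qed.

End nonlinearity.

(** * Slow variation of the derivative of the inverse *)

Section slow_variation.
Context {R : realType}.
Variables f g : R -> R.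
Hypotheses (f1 : A1 f) (fg : is_inverse_of g f) (f2 : A2 f g) (f4 : A4 g).

(** Where |ln g'| >= ln 2 this follows from [A4]; elsewhere g' >= 1 / 2 and g'' tends to 0. *)
Lemma log_slope_cvg0 : derive1n 2 g t / derive1 g t @[t --> +oo] --> (0 : R).
Proof.
have [g2 _] := f2; apply/cvgr0Pnorm_le => e e0.
have l2 : 0 < ln 2 :> R by apply: ln_gt0; lra.
have /cvgr0Pnorm_le/(_ _ (divr_gt0 e0 (ltr0n R 2))) H2 := g2.
have /cvgr0Pnorm_le/(_ _ (mulr_gt0 e0 l2)) H4 := f4.
near=> t.
have f1t : f 1 < t by near: t; apply: nbhs_pinfty_gt; rewrite num_real.
have g'0 := inverse_derive1_gt0 f1 fg f1t.
have [ln2|ln2] := leP (ln 2) `|ln (derive1 g t)|.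
  have : `|derive1n 2 g t / derive1 g t * ln (derive1 g t)| <= e * ln 2.
    by near: t.
  rewrite normrM => h; rewrite -(ler_pM2r l2); apply: le_trans h.
  by rewrite ler_wpM2l.
have g12 : 2^-1 <= derive1 g t.
  rewrite -ler_ln ?posrE ?invr_gt0// lnV ?posrE// lerNl.
  by apply: le_trans (ltW ln2); rewrite -normrN ler_norm.
rewrite normrM normfV (gtr0_norm g'0) ler_pdivrMr//.
have : `|derive1n 2 g t| <= e / 2 by near: t.
by move=> /le_trans; apply; rewrite ler_pM2l.
Unshelve. all: by end_near. Qed.

(** The quotient g'' / g' is the derivative of ln g', and it tends to 0. *)
Lemma log_derive1_lipschitz (eta : R) : 0 < eta ->
  exists2 T, f 1 < T & forall s t, T <= s -> T <= t ->
    `|ln (derive1 g t) - ln (derive1 g s)| <= eta * `|t - s|.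
Proof.
move=> eta0; have /cvgr0Pnorm_le/(_ _ eta0)[X [_ HX]] := log_slope_cvg0.
exists (Num.max X (f 1) + 1).
  by apply: (@le_lt_trans _ _ (Num.max X (f 1))); rewrite ?le_max ?lexx ?orbT// ltrDl.
move=> s t; wlog st : s t / s <= t => [H|] Ts Tt.
  by case: (leP s t) => [|/ltW] ?; [|rewrite distrC (distrC t)]; exact: H.
have big x : s <= x -> X < x /\ f 1 < x.
  move=> /(le_trans Ts) => Tx; have : Num.max X (f 1) < x by lra.
  by rewrite gt_max => /andP[].
have [|c /andP[sc ct] ->] := @mean_value _ (fun x => ln (derive1 g x))
    (fun x => (derive1 g x)^-1 * derive1n 2 g x) _ _ st.
  move=> x /andP[sx _]; have [_ fx] := big x sx.
  by apply: der_ln; [exact: inverse_derive1_gt0 fx|exact: inverse_is_derive2 fx].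
by have [Xc _] := big c sc; rewrite normrM ler_wpM2r// mulrC; exact: HX.
Qed.

Lemma ln_derive1_littleo : ln (derive1 g t) / t @[t --> +oo] --> (0 : R).
Proof.
apply/cvgr0Pnorm_le => e e0.
have [T fT HT] := log_derive1_lipschitz (divr_gt0 e0 (ltr0n R 2)).
set c := `|ln (derive1 g T)| + (e / 2) * `|T|.
near=> t.
have Tt : T <= t by near: t; apply: nbhs_pinfty_ge; rewrite num_real.
have t0 : 0 < t by near: t; apply: nbhs_pinfty_gt; rewrite num_real.
have ct : c / (e / 2) <= t by near: t; apply: nbhs_pinfty_ge; rewrite num_real.
rewrite normrM normfV (gtr0_norm t0) ler_pdivrMr//.
have := HT T t (lexx _) Tt; rewrite (ger0_norm (_ : 0 <= t - T)) ?subr_ge0// => h.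
have h2 : c <= t * (e / 2) by rewrite -ler_pdivrMr// divr_gt0.
rewrite -[ln _](subrK (ln (derive1 g T))) (le_trans (ler_normD _ _))//.
have : - T <= `|T| by rewrite -normrN ler_norm.
rewrite -(ler_pM2l (divr_gt0 e0 (ltr0n R 2))); move: h h2; rewrite /c; lra.
Unshelve. all: by end_near. Qed.

Lemma derive1_shift (S eta : R) : 0 < eta -> \forall t \near +oo, forall s,
  `|s| <= S -> f 1 < t + s /\ `|derive1 g (t + s) - derive1 g t| <= eta * derive1 g t.
Proof.
(* With this Lipschitz constant, ln g' changes by at most min(1, eta / e) under shifts |s| <= S, and
   exp is e-Lipschitz on [-1, 1]. *)
move=> eta0; pose d := Num.min 1 (eta / expR 1) / (`|S| + 1).
have S1 : 0 < `|S| + 1 by rewrite ltr_wpDl.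
have d0 : 0 < d by rewrite divr_gt0// lt_min ltr01 divr_gt0// expR_gt0.
have [T fT HT] := log_derive1_lipschitz d0.
near=> t => s sS.
have TS : T + `|S| <= t by near: t; apply: nbhs_pinfty_ge; rewrite num_real.
have sS' : - `|S| <= s.
  by rewrite lerNl (le_trans (ler_norm _))// normrN (le_trans sS)// ler_norm.
have Tt : T <= t by have := normr_ge0 S; lra.
have Tts : T <= t + s by lra.
have g0 : 0 < derive1 g t by apply: (inverse_derive1_gt0 f1 fg); lra.
have g1 : 0 < derive1 g (t + s) by apply: (inverse_derive1_gt0 f1 fg); lra.
split; first lra.
have := HT _ _ Tt Tts; rewrite addrAC subrr add0r.
set D := ln _ - ln _ => DE.
have {}DE : `|D| <= Num.min 1 (eta / expR 1).
  apply: (le_trans DE); rewrite /d mulrAC ler_pdivrMr//.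
  apply: ler_wpM2l; first by rewrite le_min ler01 divr_ge0 ?expR_ge0// ltW.
  by rewrite (le_trans sS)// (le_trans (ler_norm _))// lerDl.
have -> : derive1 g (t + s) = expR D * derive1 g t.
  by rewrite /D expRB !lnK ?posrE// divfK// gt_eqF.
rewrite -{2}[derive1 g t]mul1r -mulrBl normrM (gtr0_norm g0) ler_pM2r//.
move: DE; rewrite le_min => /andP[D1]; rewrite ler_pdivlMr ?expR_gt0// => De.
rewrite -[X in _ - X]expR0; apply: le_trans (expR_lipschitz D1 _) _.
  by rewrite normr0.
by rewrite subr0 mulrC.
Unshelve. all: by end_near. Qed.

Lemma inverse_expansion (S eta : R) : 0 < eta -> \forall t \near +oo, forall s,
  `|s| <= S -> `|g (t + s) - g t - s * derive1 g t| <= eta * derive1 g t.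
Proof.
move=> eta0; have S1 : 0 < `|S| + 1 by rewrite ltr_wpDl.
have := derive1_shift S (divr_gt0 eta0 S1); apply: filterS => t Ht s sS.
have S0 : `|0 : R| <= S by rewrite normr0 (le_trans _ sS).
have ft : f 1 < t by have [] := Ht 0 S0; rewrite addr0.
have seg x : Num.min 0 s <= x <= Num.max 0 s -> `|x| <= S.
  move=> sx; apply: le_trans sS; case: (leP 0 s) sx => s0 /andP[x1 x2].
    by rewrite !ger0_norm.
  by rewrite !ler0_norm ?(ltW s0)// lerN2.
have [||c cP E] := @mean_value _ (fun s => g (t + s)) (fun s => derive1 g (t + s))
  (Num.min 0 s) (Num.max 0 s).
- by rewrite ge_min !le_max !lexx.
- move=> x /seg /Ht[fx _]; apply: is_derive_eq (@der_comp _ g (fun s => t + s) _ _ _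
    (inverse_is_derive f1 fg fx) (derD (der_cst t x) (der_id x))) _.
  by rewrite add0r mulr1.
have {}E : g (t + s) - g t = derive1 g (t + c) * s.
  by move: E; case: (leP 0 s) => _ E; rewrite ?addr0 ?subr0 in E => //; lra.
have -> : g (t + s) - g t - s * derive1 g t = (derive1 g (t + c) - derive1 g t) * s.
  by rewrite E; ring.
have [_ h] := Ht c (seg c cP); rewrite normrM.
have g0 := inverse_derive1_gt0 f1 fg ft.
apply: (@le_trans _ _ (eta / (`|S| + 1) * derive1 g t * `|s|)).
  by rewrite ler_wpM2r.
rewrite mulrAC ler_pM2r// mulrAC ler_pdivrMr// ler_pM2l//.
by rewrite (le_trans sS)// (le_trans (ler_norm _))// lerDl.
Qed.

(** The error eta g'(t) of [inverse_expansion] is absorbed by a shift of eta: the argument of [f]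
    lies between g (t + w - eta) and g (t + w + eta), and [f] is increasing. *)
Lemma nonlinearity_expansion (M eta : R) : 0 < eta -> \forall t \near +oo,
  forall w, `|w| <= M -> 0 < g t + w * derive1 g t /\
    `|f (g t + w * derive1 g t) - (t + w)| <= eta.
Proof.
move=> eta0; have := inverse_expansion (M + eta) eta0; have := derive1_shift (M + eta) eta0.
apply: filterS2 => t H1 H2 w wM.
have M1 : `|w - eta| <= M + eta.
  by rewrite (le_trans (ler_normB _ _))// (gtr0_norm eta0) lerD2r.
have M2 : `|w + eta| <= M + eta.
  by rewrite (le_trans (ler_normD _ _))// (gtr0_norm eta0) lerD2r.
have lo : g (t + (w - eta)) <= g t + w * derive1 g t.
  by have := H2 _ M1; rewrite ler_norml => /andP[_]; lra.
have hi : g t + w * derive1 g t <= g (t + (w + eta)).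
  by have := H2 _ M2; rewrite ler_norml => /andP[+ _]; lra.
have [p1 e1] := inverse_large f1 fg (H1 _ M1).1.
have [p2 e2] := inverse_large f1 fg (H1 _ M2).1.
have p := lt_le_trans p1 lo; split => //.
have := A1_le f1 p1 lo; have := A1_le f1 p hi; rewrite e1 e2 ler_norml => h1 h2.
by apply/andP; split; lra.
Qed.

End slow_variation.

(** * The singular solution *)

Section singular_solution.
Context {R : realType}.
Variables (alpha beta gamma : R) (f g U : R -> R) (lam : R).
Hypotheses (f1 : A1 f) (fg : is_inverse_of g f) (f2 : A2 f g) (f3 : A3 g) (f4 : A4 g).
Hypothesis abc : A6 alpha beta gamma.
Hypothesis US : thm11_singular alpha beta gamma f g lam U.

Let th := theta alpha beta gamma.
Let b := beta + 1.

(** In the rescaled variable both tau and ln (r ^ (- theta)) are t plus a shift of this form, so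
    [A3] applies to them. *)
Lemma littleo_log_shift (c d : R) : littleo_id (fun t => c - d * ln (derive1 g t)).
Proof.
rewrite /littleo_id.
have -> : (fun t => (c - d * ln (derive1 g t)) / t) =
  (fun t => c * t^-1 - d * (ln (derive1 g t) / t)).
  by apply/funext => t; rewrite mulrBl -mulrA.
have -> : (0 : R) = c * 0 - d * 0 by rewrite !mulr0 subr0.
apply: cvgB; apply: cvgM; try exact: cvg_cst.
  have pos_y : \forall t \near +oo, 0 < t :> R by apply: nbhs_pinfty_gt; rewrite num_real.
  exact: (gtr0_cvgV0 pos_y).2 cvg_id.
exact: ln_derive1_littleo f1 fg f2 f4.
Qed.

Lemma littleo_shift_cvgy (h : R -> R) : littleo_id h -> t + h t @[t --> +oo] --> +oo.
Proof.
move=> /cvgr0Pnorm_le/(_ 2^-1) H; apply/cvgryPge => M.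
have {}H := H (_ : 0 < 2^-1); near=> t.
have t0 : 0 < t by near: t; apply: nbhs_pinfty_gt; rewrite num_real.
have tM : 2 * M <= t by near: t; apply: nbhs_pinfty_ge; rewrite num_real.
have : `|h t / t| <= 2^-1 by near: t; apply: H; rewrite invr_gt0.
rewrite normrM normfV (gtr0_norm t0) ler_pdivrMr// ler_norml => /andP[h1 _].
lra.
Unshelve. all: by end_near. Qed.

Lemma shift_ln_derive1_cvg (h : R -> R) : littleo_id h ->
  ln (derive1 g (t + h t)) - ln (derive1 g t) @[t --> +oo] --> (0 : R).
Proof.
move=> ho; have fty := littleo_shift_cvgy ho.
have L : ln (derive1 g t / derive1 g (t + h t)) @[t --> +oo] --> (0 : R).
  rewrite -(@ln1 R); apply: continuous_cvg (f3 ho).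
  exact: continuous_ln.
rewrite -[X in _ --> X]oppr0; apply: cvg_trans (cvgN L); apply: near_eq_cvg.
near=> t.
have t1 : f 1 < t by near: t; apply: nbhs_pinfty_gt; rewrite num_real.
have t2 : f 1 < t + h t by near: t; exact: cvgry_gt fty _.
rewrite [LHS](_ : _ = - ln (derive1 g t / derive1 g (t + h t)))//.
by rewrite ln_div ?posrE ?(inverse_derive1_gt0 f1 fg)// opprB.
Unshelve. all: by end_near. Qed.

(* Logarithm of the length scale of the regular solution of height [g t]. *)
Definition log_scale (t : R) : R := (b * ln (derive1 g t) - t) / th.

Let th0 : 0 < th. Proof. by have [_ []] := abc. Qed.
Let b0 : 0 < b. Proof. by have [_ []] := abc; rewrite /b; lra. Qed.
Let lam0 : 0 < lam. Proof. by have [] := US. Qed.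
Let pos : [/\ 0 < th, 0 < b & 0 < lam]. Proof. by []. Qed.

(** The point where [U] is evaluated when the rescaled singular solution is taken at radius exp (x +
    log_scale t). *)
Let r (x t : R) := expR (x + log_scale t) * lam `^ (- th^-1).

Let rE (x t : R) : r x t = expR (x + log_scale t - ln lam / th).
Proof.
rewrite /r /powR gt_eqF// -expRD; congr expR.
by rewrite mulNr [_^-1 * _]mulrC.
Qed.

Let ln_rE (x t : R) : th * ln (r x t) = th * x + b * ln (derive1 g t) - t - ln lam.
Proof.
have [hth hb hlam] := pos.
by rewrite rE expRK /log_scale; field; nz.
Qed.

Let tau_rE (x t : R) :
  ln (b / (lam * r x t `^ th)) = t + (ln b - th * x - b * ln (derive1 g t)).
Proof.
have r0 : 0 < r x t by rewrite rE expR_gt0.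
rewrite ln_div ?posrE ?mulr_gt0 ?powR_gt0// lnM ?posrE ?powR_gt0// ln_powR ln_rE.
ring.
Qed.

(** The terms - ln lam - theta ln r contribute t - theta x - b ln g'(t). The last logarithm is b ln
    g'(tau) up to a factor 1 + p inside it, where p tends to 0 by [A4]; by [A3] the two logarithms
    of g' cancel in the limit. *)
Lemma Zfun_cvg (x : R) :
  Zfun alpha beta gamma lam g (r x t) - t @[t --> +oo]
    --> ln (th `^ b * (alpha - beta - 1)) - th * x.
Proof.
pose h t := ln b - th * x - b * ln (derive1 g t).
have ho : littleo_id h by exact: littleo_log_shift.
have hy := littleo_shift_cvgy ho.
have L1 := shift_ln_derive1_cvg ho.
pose p t := b * (derive1n 2 g t / derive1 g t * ln (derive1 g t)).
have p0 : p t @[t --> +oo] --> (0 : R).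
  by rewrite -[X in _ --> X](mulr0 b); apply: cvgM; [exact: cvg_cst|exact: f4].
have ph0 : p (t + h t) @[t --> +oo] --> (0 : R) by apply: (cvg_comp _ p hy p0).
have L2 : ln (1 + p (t + h t)) @[t --> +oo] --> (0 : R).
  rewrite -(@ln1 R); apply: continuous_cvg; first exact: continuous_ln.
  by rewrite -[X in _ --> X](addr0 1); apply: cvgD => //; exact: cvg_cst.
set ys := ln _.
have -> : ys - th * x = ys - th * x + (b * 0 + b * 0) by ring.
suff E : \forall t \near +oo, ys - th * x +
    (b * (ln (derive1 g (t + h t)) - ln (derive1 g t)) + b * ln (1 + p (t + h t)))
    = Zfun alpha beta gamma lam g (r x t) - t.
  apply: cvg_trans (near_eq_cvg E) _.
  by apply: cvgD; [exact: cvg_cst|apply: cvgD; apply: cvgM => //; exact: cvg_cst].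
near=> t.
have t2 : f 1 < t + h t by near: t; exact: cvgry_gt hy _.
have g'0 := inverse_derive1_gt0 f1 fg t2.
have pt : `|p (t + h t)| <= 2^-1.
  by near: t; move/cvgr0Pnorm_le: ph0; apply; rewrite invr_gt0.
rewrite /Zfun -/b -/th tau_rE -/(h t) -/ys ln_rE.
have -> : derive1 g (t + h t) + b * derive1n 2 g (t + h t) * ln (derive1 g (t + h t))
  = derive1 g (t + h t) * (1 + p (t + h t)).
  by rewrite /p; field; nz.
rewrite lnM ?posrE//; last by move: pt; rewrite ler_norml => /andP[? _]; lra.
ring.
Unshelve. all: by end_near. Qed.

(** Three errors are compared with g'(t): [D t] against its limit, the linearisation of [g] at [t],
    and the O(g'') term, which is o(g'(t)) because g'' / g' tends to 0 and g' varies slowly. *)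
Lemma singular_asymptotics (x : R) :
  (U (r x t) - g t) / derive1 g t @[t --> +oo]
    --> ln (th `^ b * (alpha - beta - 1)) - th * x.
Proof.
set c := _ - _.
pose D t := Zfun alpha beta gamma lam g (r x t) - t.
have Dc : D t @[t --> +oo] --> c by exact: Zfun_cvg.
have [_ [_ [_ [_ [_ [C [d d0 HC]]]]]]] := US.
(* [t + h t] equals ln (r ^ (- theta)), where the O(g'') error is evaluated. *)
pose h t := ln lam - th * x - b * ln (derive1 g t).
have ho : littleo_id h by exact: littleo_log_shift.
have hy := littleo_shift_cvgy ho.
have L1 : expR (ln (derive1 g (t + h t)) - ln (derive1 g t)) @[t --> +oo] --> (1 : R).
  rewrite -(@expR0 R); apply: continuous_cvg (shift_ln_derive1_cvg ho).
  exact: continuous_expR.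
have L2 : derive1n 2 g (t + h t) / derive1 g (t + h t) @[t --> +oo] --> (0 : R).
  exact: cvg_comp hy (log_slope_cvg0 f1 fg f2 f4).
have L3 : `|C| * `|derive1n 2 g (t + h t) / derive1 g (t + h t) *
    expR (ln (derive1 g (t + h t)) - ln (derive1 g t))| @[t --> +oo] --> (0 : R).
  rewrite [X in _ --> X](_ : 0 = `|C| * `|(0 : R) * 1|); last by rewrite mul0r normr0 mulr0.
  by apply: cvgM; [exact: cvg_cst|apply: cvg_norm; exact: cvgM].
apply/cvgrPdist_le => e e0.
have e30 : 0 < e / 3 by rewrite divr_gt0.
move/cvgrPdist_le/(_ _ e30) : Dc => Dc.
move/cvgr0Pnorm_le/(_ _ e30) : L3 => L3.
near=> t.
have t1 : f 1 < t by near: t; apply: nbhs_pinfty_gt; rewrite num_real.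
have t2 : f 1 < t + h t by near: t; exact: cvgry_gt hy _.
have g0 := inverse_derive1_gt0 f1 fg t1.
have g2 := inverse_derive1_gt0 f1 fg t2.
have h1 : `|c - D t| <= e / 3 by near: t.
(* The expansion is uniform over bounded shifts, so it applies at the moving shift [D t]. *)
have h2 : `|g (t + D t) - g t - D t * derive1 g t| <= e / 3 * derive1 g t.
  have : `|D t| <= `|c| + e / 3.
    by rewrite -[D t](subKr c) (le_trans (ler_normB _ _))// lerD2l.
  by move: (D t); near: t; exact: (inverse_expansion f1 fg f2 f4 _ e30).
have h3 : `|U (r x t) - g (t + D t)| <= e / 3 * derive1 g t.
  have r0 : 0 < r x t by rewrite rE expR_gt0.
  have rd : r x t < d.
    rewrite -[ltRHS]lnK ?posrE// -[ltLHS]lnK ?posrE// ltr_expR -(ltr_pM2l th0) ln_rE.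
    have : - (th * ln d) < t + h t by near: t; exact: cvgry_gt hy _.
    by rewrite /h; lra.
  have := HC (r x t) _ r0; rewrite /= sub0r normrN (gtr0_norm r0) => /(_ rd).
  rewrite ln_powR -/th mulNr ln_rE.
  have -> : - (th * x + b * ln (derive1 g t) - t - ln lam) = t + h t by rewrite /h; ring.
  have -> : t + D t = Zfun alpha beta gamma lam g (r x t) by rewrite /D; ring.
  move=> /le_trans; apply; rewrite -ler_pdivrMr//.
  have : `| `|C| * `|derive1n 2 g (t + h t) / derive1 g (t + h t) *
    expR (ln (derive1 g (t + h t)) - ln (derive1 g t))| | <= e / 3 by near: t.
  rewrite expRB !lnK ?posrE// mulrA divfK ?gt_eqF// normrM !normr_id.
  apply: le_trans; rewrite normrM normfV (gtr0_norm g0) mulrA ler_pM2r ?invr_gt0//.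
  by rewrite ler_wpM2r// ler_norm.
have -> : c - (U (r x t) - g t) / derive1 g t = (c - D t)
  - (g (t + D t) - g t - D t * derive1 g t) / derive1 g t
  - (U (r x t) - g (t + D t)) / derive1 g t by field; nz.
rewrite (le_trans (ler_normB _ _))// (_ : e = e / 3 + e / 3 + e / 3); last by field.
apply: lerD; last by rewrite normrM normfV (gtr0_norm g0) ler_pdivrMr.
rewrite (le_trans (ler_normB _ _))//; apply: lerD => //.
by rewrite normrM normfV (gtr0_norm g0) ler_pdivrMr.
Unshelve. all: by end_near. Qed.

End singular_solution.

(** * Regular solutions in logarithmic variables *)

Section regular_solution.
Context {R : realType}.
Variables (alpha beta gamma : R) (f : R -> R) (rho : R) (u : R -> R) (Rmax : \bar R).
Hypotheses (f1 : A1 f) (abc : A6 alpha beta gamma).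
Hypothesis ru : regular_solution alpha beta gamma f rho u Rmax.

Let th := theta alpha beta gamma.
Let b := beta + 1.
Let k := alpha - beta - 1.

Let pos : [/\ 0 < th, 0 < k, 1 <= b, 0 < b & 0 < gamma + 1].
Proof. by have [] := abc; rewrite /th /k /b /theta => ? [? ?]; split; lra. Qed.

Let abE : [/\ alpha = k + b, gamma + 1 = th + k & beta = b - 1].
Proof. by rewrite /th /k /b /theta; split; ring. Qed.

(* [x = ln r]. *)
Definition neg_flux (x : R) : R := - flux alpha beta u (expR x).
Let Psi := neg_flux.
Let W (x : R) := u (expR x).
Let dom (x : R) := ((expR x)%:E < Rmax)%E.

Let dom_le x y : x <= y -> dom y -> dom x.
Proof. by move=> xy; apply: le_lt_trans; rewrite lee_fin ler_expR. Qed.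

Let u_pos x : dom x -> 0 < W x.
Proof. by have [_ [_ [_ [_ [H _]]]]] := ru; apply: H; rewrite expR_ge0. Qed.

Let expR_small (c C e : R) : 0 < c -> 0 < e ->
  exists x0, forall x, x <= x0 -> C * expR (c * x) <= e.
Proof.
move=> c0 e0; have C1 : 0 < `|C| + 1 by rewrite ltr_wpDl.
exists (ln (e / (`|C| + 1)) / c) => x.
rewrite ler_pdivlMr// mulrC => xe.
apply: (@le_trans _ _ ((`|C| + 1) * expR (c * x))).
  by rewrite ler_pM2r ?expR_gt0// (le_trans (ler_norm _))// lerDl.
by rewrite mulrC -ler_pdivlMr// -[leRHS]lnK ?posrE ?divr_gt0// ler_expR.
Qed.

Let rquot_small (e : R) : 0 < e ->
  exists x0, forall x, x <= x0 -> `|W x - rho| <= e * expR x.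
Proof.
move=> e0; have [_ [u0 [uD _]]] := ru.
move/cvgr0Pnorm_le/(_ _ e0) : uD => [d d0 Hd].
exists (ln (d / 2)) => x xd.
have ed : expR x < d.
  apply: (@le_lt_trans _ _ (d / 2)); last by have : 0 < d by []; lra.
  by rewrite -[leRHS]lnK ?posrE ?divr_gt0// ler_expR.
have := Hd (expR x); rewrite /= sub0r normrN gtr0_norm ?expR_gt0// => /(_ ed isT).
by rewrite u0 normrM normfV (gtr0_norm (expR_gt0 _)) ler_pdivrMr ?expR_gt0.
Qed.

Let W_near0 (e : R) : 0 < e -> exists x0, forall x, x <= x0 -> `|W x - rho| <= e.
Proof.
move=> e0; have [x0 H] := rquot_small ltr01.
have [x1 H1] := @expR_small 1 1 e ltr01 e0.
exists (Num.min x0 x1) => x; rewrite le_min => /andP[/H h /H1].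
by rewrite !mul1r in h *; exact: le_trans h.
Qed.

Let du x : dom x -> is_derive (expR x) 1 u (derive1 u (expR x)).
Proof.
have [_ [_ [_ [sol _]]]] := ru => dx.
have [|D _] := sol (expR x); first by split; [exact: expR_gt0|exact: dx].
by apply: (DeriveDef D); rewrite derive1E.
Qed.

Let dW x : dom x -> is_derive x 1 W (derive1 u (expR x) * expR x).
Proof. by move=> /du D; exact: (der_comp D (is_derive_expR x)). Qed.

Let dPsi x : dom x -> is_derive x 1 Psi (expR ((gamma + 1) * x) * expR (f (W x))).
Proof.
have [_ [_ [_ [sol _]]]] := ru => dx.
have [|_ [D E]] := sol (expR x); first by split; [exact: expR_gt0|exact: dx].
have {}D : is_derive (expR x) 1 (flux alpha beta u)
    (derive1 (flux alpha beta u) (expR x)).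
  by apply: (DeriveDef D); rewrite derive1E.
apply: is_derive_eq (derN (der_comp D (is_derive_expR x))) _.
move: E; rewrite /powR gt_eqF ?expR_gt0// expRK mul1r -/(W x) mulNr expRN.
set d := derive1 _ _ => E.
have -> : (gamma + 1) * x = gamma * x + x by ring.
rewrite expRD; have e0 : expR (gamma * x) != 0 by rewrite gt_eqF ?expR_gt0.
have -> : d = - (expR (gamma * x) * expR (f (W x))).
  by apply: (mulfI (invr_neq0 e0)); rewrite mulrN mulKf//; lra.
ring.
Qed.

(** The initial condition controls difference quotients at 0, not u' near 0; the mean value theorem
    still yields points arbitrarily close to 0 where |u'| <= 1. *)
Let flux_small x1 : dom x1 -> exists x, x <= x1 /\ `|Psi x| <= expR (alpha * x).
Proof.
move=> dx1; have [hth hk hb1 hb hg] := pos; have [aE gE bE] := abE.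
(* With 1 / 4, u changes by at most 3/8 e ^ x between radii e ^ x / 2 and e ^ x, which is less than
   their distance. *)
have [|x0 H] := @rquot_small 4^-1; first by rewrite invr_gt0.
pose x := Num.min x0 x1; have xx0 : x <= x0 by rewrite ge_min lexx.
have xx1 : x <= x1 by rewrite ge_min lexx orbT.
have ex := expR_gt0 x.
have l2 : 0 < ln 2 :> R by apply: ln_gt0; lra.
pose y := x - ln 2; have yE : expR y = expR x / 2 by rewrite expRB lnK ?posrE.
have yx : y <= x by rewrite /y; lra.
have [r /andP[yr rx] E] : exists2 r, expR y <= r <= expR x &
    u (expR x) - u (expR y) = derive1 u r * (expR x - expR y).
  apply: mean_value; first by rewrite ler_expR.
  move=> r /andP[yr rx]; have r0 : 0 < r := lt_le_trans (expR_gt0 y) yr.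
  have := @du (ln r); rewrite lnK ?posrE//; apply.
  by rewrite /dom lnK ?posrE// (le_lt_trans _ (dom_le xx1 dx1))// lee_fin.
have r0 : 0 < r := lt_le_trans (expR_gt0 y) yr.
exists (ln r); split.
  by rewrite (le_trans _ xx1)// -ler_expR lnK ?posrE.
have u1 : `|derive1 u r| <= 1.
  have h1 := H x xx0; have h2 := H y (le_trans yx xx0).
  have h0 : 0 < expR x - expR y by rewrite yE; lra.
  rewrite -(ler_pM2r h0) -{1}(gtr0_norm h0) -normrM -E mul1r.
  have -> : u (expR x) - u (expR y) = (W x - rho) - (W y - rho) by rewrite /W; ring.
  rewrite (le_trans (ler_normB _ _))//; move: h1 h2; rewrite yE; lra.
rewrite /Psi /neg_flux normrN /flux lnK ?posrE// !normrM.
rewrite (ger0_norm (powR_ge0 _ _)) (ger0_norm (powR_ge0 _ _)).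
have -> : expR (alpha * ln r) = r `^ alpha by rewrite /powR gt_eqF.
rewrite -mulrA -[leRHS]mulr1 ler_pM2l ?powR_gt0//.
rewrite mulr_ile1 ?powR_ge0//.
rewrite -[leRHS](_ : 1 `^ beta = 1); last by rewrite powR1.
by apply: ge0_ler_powR; rewrite ?nnegrE//; lra.
Qed.

(** The negated flux is strictly increasing in x, and by [flux_small] it is arbitrarily small at
    points going to - oo; a nonpositive value would keep it below a negative constant further
    left. *)
Lemma neg_flux_gt0 x : dom x -> 0 < Psi x.
Proof.
move=> dx; have [hth hk hb1 hb hg] := pos; have [aE gE bE] := abE.
rewrite ltNge; apply/negP => P0.
have incr s t : s < t -> t <= x -> Psi s < Psi t.
  move=> st tx; apply: (gtr0_der_lt st) => y /andP[_ yt].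
    by apply: dPsi; apply: dom_le dx; exact: le_trans tx.
  by rewrite mulr_gt0 ?expR_gt0.
have c0 : Psi (x - 1) < 0.
  by apply: lt_le_trans P0; apply: incr => //; rewrite ltrBlDr ltrDl.
have a0 : 0 < alpha by lra.
have [|x0 H] := @expR_small alpha 1 (- Psi (x - 1) / 2) a0.
  by rewrite divr_gt0// oppr_gt0.
pose y := Num.min x0 (x - 1) - 1.
have yx0 : y <= x0.
  rewrite /y; have : Num.min x0 (x - 1) <= x0 by rewrite ge_min lexx.
  by lra.
have yx1 : y < x - 1.
  rewrite /y; have : Num.min x0 (x - 1) <= x - 1 by rewrite ge_min lexx orbT.
  by lra.
have dy : dom y by apply: dom_le dx; lra.
have [s [sy sP]] := flux_small dy.
have := H s (le_trans sy yx0); rewrite mul1r => sP2.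
have sx1 : Psi s < Psi (x - 1) by apply: incr; [exact: le_lt_trans yx1|lra].
have := ler_norm (- Psi s); rewrite normrN; lra.
Qed.

(** The right-hand side is the integral from - oo of the flux derivative with f (u) replaced by [t];
    the comparison starts at points given by [flux_small]. *)
Lemma neg_flux_le (t x : R) : dom x -> (forall y, y <= x -> f (W y) <= t) ->
  Psi x <= expR (t - ln (gamma + 1) + (gamma + 1) * x).
Proof.
move=> dx ft; have [hth hk hb1 hb hg] := pos; have [aE gE bE] := abE.
have a0 : 0 < alpha by lra.
pose E y := expR (t - ln (gamma + 1) + (gamma + 1) * y).
rewrite -subr_le0 leNgt; apply/negP => D0.
have [x0 H] := @expR_small alpha 1 _ a0 (divr_gt0 D0 (ltr0n R 2)).
have [y1x y1x0] : Num.min x0 x <= x /\ Num.min x0 x <= x0.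
  by rewrite !ge_min !lexx orbT.
have [s [sy sP]] := flux_small (dom_le y1x dx).
have := H s (le_trans sy y1x0); rewrite mul1r => sP2.
have sx := le_trans sy y1x.
suff : E s - Psi s <= E x - Psi x.
  have := expR_gt0 (t - ln (gamma + 1) + (gamma + 1) * s); rewrite -/(E s) -/(E x) in D0 sP2 *.
  have := ler_norm (Psi s); lra.
apply: (@ger0_der_le _ (fun y => E y - Psi y) (fun y => E y * (gamma + 1)
   - expR ((gamma + 1) * y) * expR (f (W y))) _ _ sx) => y /andP[sy' yx].
  apply: derD; last by apply: derN; exact: dPsi (dom_le yx dx).
  by rewrite /E; der; ring.
rewrite /E expRD expRB lnK ?posrE// mulrAC divfK ?gt_eqF// mulrC -mulrBr.
by rewrite mulr_ge0 ?expR_ge0// subr_ge0 ler_expR ft.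
Qed.

Lemma neg_flux_ge (t x : R) : dom x -> (forall y, y <= x -> t <= f (W y)) ->
  expR (t - ln (gamma + 1) + (gamma + 1) * x) <= Psi x.
Proof.
move=> dx ft; have [hth hk hb1 hb hg] := pos; have [aE gE bE] := abE.
pose E y := expR (t - ln (gamma + 1) + (gamma + 1) * y).
rewrite -subr_le0 leNgt; apply/negP => D0.
have [x0 H] := @expR_small (gamma + 1) (expR (t - ln (gamma + 1))) _ hg
  (divr_gt0 D0 (ltr0n R 2)).
pose s := Num.min x0 x.
have [sx sx0] : s <= x /\ s <= x0 by rewrite !ge_min !lexx orbT.
have := H s sx0; rewrite -expRD -/(E s) => sP2.
have Ps := neg_flux_gt0 (dom_le sx dx).
suff : Psi s - E s <= Psi x - E x by rewrite -/(E x) in D0 sP2 *; lra.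
apply: (@ger0_der_le _ (fun y => Psi y - E y) (fun y => expR ((gamma + 1) * y) * expR (f (W y)) -
   E y * (gamma + 1)) _ _ sx) => y /andP[sy' yx].
  apply: derD; first exact: dPsi (dom_le yx dx).
  by apply: derN; rewrite /E; der; ring.
rewrite /E expRD expRB lnK ?posrE// mulrAC divfK ?gt_eqF// [expR t * _]mulrC -mulrBr.
by rewrite mulr_ge0 ?expR_ge0// subr_ge0 ler_expR ft.
Qed.

(** Positivity of the negated flux forces u' < 0, so the flux can be solved for r u', using alpha =
    k + b. *)
Lemma regular_is_derive x : dom x ->
  is_derive x 1 W (- expR ((ln (Psi x) - k * x) / b)).
Proof.
move=> dx; have [hth hk hb1 hb hg] := pos; have [aE gE bE] := abE.
apply: is_derive_eq (dW dx) _.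
have := neg_flux_gt0 dx; rewrite /Psi /neg_flux /flux.
set v := derive1 u (expR x); rewrite oppr_gt0 => P0.
have ex : 0 < expR x `^ alpha by rewrite powR_gt0 ?expR_gt0.
have v0 : v < 0.
  rewrite ltNge; apply/negP => v0; move: P0.
  by rewrite ltNge (mulr_ge0 (mulr_ge0 (powR_ge0 _ _) (powR_ge0 _ _)) v0).
have nv : 0 < - v by rewrite oppr_gt0.
rewrite (ltr0_norm v0) -mulrN lnM ?posrE ?mulr_gt0 ?powR_gt0 ?expR_gt0//.
rewrite lnM ?posrE ?powR_gt0 ?expR_gt0// !ln_powR expRK.
have -> : (alpha * x + beta * ln (- v) + ln (- v) - k * x) / b = x + ln (- v).
  by rewrite aE bE; field; nz.
by rewrite expRD lnK ?posrE//; ring.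
Qed.

Lemma regular_le x : dom x -> W x <= rho.
Proof.
move=> dx; apply/ler_addgt0Pr => e e0; have [x0 H] := W_near0 e0.
pose s := Num.min x0 x.
have [sx sx0] : s <= x /\ s <= x0 by rewrite !ge_min !lexx orbT.
have : W x <= W s.
  rewrite -lerN2; apply: (@ger0_der_le _ (fun y => - W y)
    (fun y => - - expR ((ln (Psi y) - k * y) / b)) _ _ sx) => y /andP[_ yx].
    exact: derN (regular_is_derive (dom_le yx dx)).
  by rewrite opprK expR_ge0.
by have := H s sx0; rewrite ler_norml => /andP[_]; lra.
Qed.

(** As u <= rho, the flux is bounded with f (u) replaced by f rho; integrating the resulting bound
    on - r u' gives the exponential, its rate being (gamma + 1 - k) / b = th / b. *)
Lemma regular_ge x : dom x ->
  rho - b / th * expR ((f rho - ln (gamma + 1) + th * x) / b) <= W x.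
Proof.
move=> dx; have [hth hk hb1 hb hg] := pos; have [aE gE bE] := abE.
rewrite lerBlDr; apply/ler_addgt0Pr => e e0; have [x0 H] := W_near0 e0.
pose s := Num.min x0 x.
have [sx sx0] : s <= x /\ s <= x0 by rewrite !ge_min !lexx orbT.
pose E y := b / th * expR ((f rho - ln (gamma + 1) + th * y) / b).
have : W s + E s <= W x + E x.
  apply: (@ger0_der_le _ (fun y => W y + E y) (fun y => - expR ((ln (Psi y) - k * y) / b)
     + expR ((f rho - ln (gamma + 1) + th * y) / b)) _ _ sx) => y /andP[_ yx].
    apply: derD; first exact: regular_is_derive (dom_le yx dx).
    by rewrite /E; der; field; nz.
  have dy := dom_le yx dx.
  rewrite addrC subr_ge0 ler_expR ler_pM2r ?invr_gt0//.
  have : Psi y <= expR (f rho - ln (gamma + 1) + (gamma + 1) * y).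
    apply: neg_flux_le => // s' s'y; have ds := dom_le s'y dy.
    exact: (A1_le f1 (u_pos ds) (regular_le ds)).
  rewrite -ler_ln ?posrE ?expR_gt0 ?neg_flux_gt0// expRK gE; lra.
have E0 : 0 <= E s by rewrite mulr_ge0 ?expR_ge0// divr_ge0 ?ltW.
have := H s sx0; rewrite ler_norml => /andP[+ _]; rewrite -/(E x); lra.
Qed.

Lemma neg_flux_is_derive x : dom x ->
  is_derive x 1 (fun y => ln (Psi y))
    (expR ((gamma + 1) * x + f (W x) - ln (Psi x))).
Proof.
move=> dx; have P0 := neg_flux_gt0 dx.
apply: is_derive_eq (der_ln P0 (dPsi dx)) _.
by rewrite expRB expRD lnK ?posrE// mulrC.
Qed.

End regular_solution.

(** * Rescaled solutions *)

Section scaling.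
Context {R : realType}.
Variables (alpha beta gamma : R) (f g : R -> R).
Hypotheses (f1 : A1 f) (abc : A6 alpha beta gamma).

Let th := theta alpha beta gamma.
Let b := beta + 1.
Let k := alpha - beta - 1.
Let ys := ln (th `^ b * k).

(* The difference to the limit [ys - th x] of the rescaled singular solution. *)
Definition scaled_height (u : R -> R) (rho x : R) : R :=
  (u (expR (x + log_scale alpha beta gamma g (f rho))) - rho)
    / derive1 g (f rho) + th * x - ys.

(** The variable [a]: where the negated flux is positive, this is ln (- r u' / (theta g'(t))),
    expressed through the flux because the flux is what the equation differentiates. *)
Definition scaled_log_slope (u : R -> R) (rho x : R) : R :=
  (ln (neg_flux alpha beta u (x + log_scale alpha beta gamma g (f rho)))
   - k * (x + log_scale alpha beta gamma g (f rho))) / b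
  - ln (derive1 g (f rho)) - ln th.

(* Bounds [(rho - u) / g'(t)] in the rescaled variable. *)
Definition drop_bound (x : R) : R := b / th * expR ((th * x - ln (gamma + 1)) / b).

Let pos : [/\ 0 < th, 0 < k, 1 <= b, 0 < b & 0 < gamma + 1].
Proof. by have [] := abc; rewrite /th /k /b /theta => ? [? ?]; split; lra. Qed.

Let abE : [/\ alpha = k + b, gamma + 1 = th + k & beta = b - 1].
Proof. by rewrite /th /k /b /theta; split; ring. Qed.

Let ysE : ys = b * ln th + ln k.
Proof.
have [hth hk hb1 hb hg] := pos.
by rewrite /ys lnM ?posrE ?powR_gt0// ln_powR.
Qed.

Section fixed_height.
Variables (u : R -> R) (rho : R) (Rmax : \bar R) (X eta : R).
Hypothesis ru : regular_solution alpha beta gamma f rho u Rmax.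
Hypotheses (g1 : 0 < derive1 g (f rho)) (eta1 : eta <= 1).
Hypothesis expansion : forall w, `|w| <= drop_bound X ->
  0 < rho + w * derive1 g (f rho) /\
  `|f (rho + w * derive1 g (f rho)) - (f rho + w)| <= eta.

Let G := derive1 g (f rho).
Let l := log_scale alpha beta gamma g (f rho).
Let Z := scaled_height u rho.
Let A := scaled_log_slope u rho.
Let w (x : R) := (u (expR (x + l)) - rho) / G.

Let lE : th * l = b * ln G - f rho.
Proof.
by have [hth hk hb1 hb hg] := pos; rewrite /l /log_scale -/th -/b mulrC divfK ?gt_eqF.
Qed.

Let drop_le (x y : R) : x <= y -> drop_bound x <= drop_bound y.
Proof.
have [hth hk hb1 hb hg] := pos => xy.
by rewrite ler_pM2l ?divr_gt0// ler_expR ler_pM2r ?invr_gt0// lerD2r ler_pM2l.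
Qed.

Let drop_ge0 (x : R) : 0 <= drop_bound x.
Proof.
by have [hth hk hb1 hb hg] := pos; rewrite mulr_ge0 ?expR_ge0// divr_ge0 ?ltW.
Qed.

Let dropE (x : R) :
  b / th * expR ((f rho - ln (gamma + 1) + th * (x + l)) / b) = drop_bound x * G.
Proof.
have [hth hk hb1 hb hg] := pos.
rewrite /drop_bound -[in RHS](lnK (_ : G \is Num.pos)) ?posrE// -[RHS]mulrA -expRD.
by rewrite mulrDr lE; congr (_ * expR _); field; nz.
Qed.

(** If the interval ended earlier, u would tend to 0 at its end; but the drop bound keeps u above
    rho - drop_bound X g'(t), which [expansion] makes positive. *)
Lemma scaled_dom (x : R) : x <= X -> ((expR (x + l))%:E < Rmax)%E.
Proof.
have hG : 0 < G by exact: g1.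
move=> xX; rewrite ltNge; apply/negP => RX.
have [R0 [_ [_ [_ [_ [Ry|[Rf [RE uRf]]]]]]]] := ru; first by rewrite Ry in RX.
rewrite RE lte_fin in R0; rewrite RE lee_fin in RX.
have [|c0 _] := @expansion (- drop_bound X); first by rewrite normrN ger0_norm ?drop_ge0.
suff : rho + - drop_bound X * G <= 0 by rewrite leNgt c0.
apply: (cvgr_to_ge uRf); near=> r.
have r0 : 0 < r by near: r; exact: nbhs_left_gt.
have rR : r < Rf by near: r; exact: nbhs_left_lt.
have := @regular_ge _ _ _ _ _ _ _ _ f1 abc ru (ln r).
rewrite lnK ?posrE// RE lte_fin => /(_ rR).
have -> : ln r = (ln r - l) + l by ring.
rewrite -/th -/b dropE; apply: le_trans.
rewrite mulNr lerD2l lerN2 ler_pM2r//; apply: drop_le.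
rewrite lerBlDr; apply: (@le_trans _ _ (x + l)); last by rewrite lerD2r.
by rewrite -ler_expR lnK ?posrE// (le_trans (ltW rR)).
Unshelve. all: by end_near. Qed.

Lemma scaled_drop (x : R) : x <= X -> - drop_bound x <= w x <= 0.
Proof.
move=> xX; have hG : 0 < G by exact: g1.
have dx := scaled_dom xX.
have := regular_ge f1 abc ru dx; have := regular_le abc ru dx.
rewrite -/th -/b dropE /w -/l => h1 h2.
rewrite ler_pdivlMr// ler_pdivrMr// mul0r subr_le0 h1 andbT mulNr.
lra.
Qed.

Let uE (x : R) : u (expR (x + l)) = rho + w x * G.
Proof. by rewrite /w divfK ?gt_eqF//; ring. Qed.

Let f_uE (x : R) : x <= X -> `|f (u (expR (x + l))) - (f rho + w x)| <= eta.
Proof.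
move=> xX; rewrite uE; apply: (expansion _).2.
have /andP[w1 w2] := scaled_drop xX.
by rewrite ler0_norm// lerNl (le_trans _ w1)// lerN2 drop_le.
Qed.

Let heightE (x : R) : Z x = w x + th * x - ys. Proof. by []. Qed.

Let slopeE (x : R) :
  ln (neg_flux alpha beta u (x + l)) = b * (A x + ln G + ln th) + k * (x + l).
Proof.
have [hth hk hb1 hb hg] := pos.
rewrite /A /scaled_log_slope -/l -/G; set c := ln _; set p := ln _; set q := ln _.
by field; nz.
Qed.

Lemma scaled_log_slope_bounds (x : R) : x <= X ->
  (th * x - ln (gamma + 1) - drop_bound X - 1) / b - ln th <= A x
    <= (th * x - ln (gamma + 1)) / b - ln th.
Proof.
move=> xX; have [hth hk hb1 hb hg] := pos; have [aE gE bE] := abE.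
have he1 := eta1; have dx := scaled_dom xX; have P0 := neg_flux_gt0 abc ru dx.
have below y : y <= x + l -> y = (y - l) + l /\ y - l <= X.
  by move=> yx; split; [ring|lra].
have h1 : ln (neg_flux alpha beta u (x + l)) <=
    f rho - ln (gamma + 1) + (gamma + 1) * (x + l).
  rewrite -[leRHS]expRK ler_ln ?posrE ?expR_gt0//.
  apply: (neg_flux_le abc ru dx) => y /below[yE yX]; rewrite yE.
  have dy := scaled_dom yX.
  apply: (A1_le f1); last exact: (regular_le abc ru dy).
  by have [_ [_ [_ [_ [H _]]]]] := ru; apply: H; rewrite ?expR_ge0.
(* f (u) is at least f rho + w - eta, with w >= - drop_bound X and eta <= 1. *)
have h2 : f rho - drop_bound X - 1 - ln (gamma + 1) + (gamma + 1) * (x + l) <=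
    ln (neg_flux alpha beta u (x + l)).
  rewrite -[leLHS]expRK ler_ln ?posrE ?expR_gt0//.
  apply: (neg_flux_ge abc ru dx) => y /below[yE yX]; rewrite yE.
  have /andP[wl _] := scaled_drop yX; have := f_uE yX; have := drop_le yX.
  by rewrite ler_norml => h /andP[h' _]; lra.
have tl := lE; rewrite slopeE in h1 h2.
rewrite gE in h1 h2 *; apply/andP; split.
  by rewrite lerBlDr ler_pdivrMr//; lra.
by rewrite lerBrDr ler_pdivlMr//; lra.
Qed.

Lemma scaled_height_is_derive (x : R) : x <= X ->
  is_derive x 1 Z (- th * (expR (A x) - 1)).
Proof.
move=> xX; have [hth hk hb1 hb hg] := pos.
have D := regular_is_derive abc ru (scaled_dom xX).
have D2 := @der_comp _ (fun y => u (expR y)) (fun y => y + l) x _ _ D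
  (derD (der_id x) (der_cst l x)).
have hG : 0 < G by exact: g1.
rewrite /Z /scaled_height; apply: is_derive_eq.
rewrite !scaler0 /GRing.scale/= slopeE -/k -/b.
have -> : (b * (A x + ln G + ln th) + k * (x + l) - k * (x + l)) / b =
  A x + ln G + ln th by field; nz.
by rewrite 2!expRD !lnK ?posrE// -/G; field; nz.
Qed.

(** The rescaling is exact except in the nonlinearity: [e] is the error f (u) - (t + w). *)
Lemma scaled_log_slope_is_derive (x : R) : x <= X ->
  exists2 e, `|e| <= eta &
    is_derive x 1 A (k / b * (expR (Z x - b * A x + e) - 1)).
Proof.
move=> xX; have [hth hk hb1 hb hg] := pos; have [aE gE bE] := abE.
exists (f (u (expR (x + l))) - (f rho + w x)); first exact: f_uE.
have D := neg_flux_is_derive abc ru (scaled_dom xX).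
have D2 := @der_comp _ (fun y => ln (neg_flux alpha beta u y)) (fun y => y + l) x _ _ D
  (derD (der_id x) (der_cst l x)).
set rhs := k / b * _; rewrite /A /scaled_log_slope; apply: is_derive_eq.
rewrite !scaler0 /GRing.scale/= slopeE; set fu := f _.
have -> : (gamma + 1) * (x + l) + fu - (b * (A x + ln G + ln th) + k * (x + l)) =
  w x + th * x - (b * ln th + ln k) - b * A x + (fu - (f rho + w x)) + ln k.
  by have := lE; rewrite gE; lra.
rewrite [expR (_ + ln k)]expRD lnK ?posrE// /rhs heightE ysE; field; nz.
Qed.

End fixed_height.

End scaling.

(** * Uniform estimates for large heights *)

Section scaled_family.
Context {R : realType}.
Variables (alpha beta gamma : R) (f g : R -> R).
Variables (u : R -> R -> R) (Rmax : R -> \bar R).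
Hypotheses (f1 : A1 f) (fg : is_inverse_of g f) (f2 : A2 f g) (f4 : A4 g).
Hypothesis abc : A6 alpha beta gamma.
Hypothesis ru : forall rho, 0 < rho ->
  regular_solution alpha beta gamma f rho (u rho) (Rmax rho).

Let th := theta alpha beta gamma.
Let b := beta + 1.
Let k := alpha - beta - 1.
Let ys := ln (th `^ b * k).
Let Z rho := scaled_height alpha beta gamma f g (u rho) rho.
Let A rho := scaled_log_slope alpha beta gamma f g (u rho) rho.
Let M X := drop_bound alpha beta gamma X.

Let pos : [/\ 0 < th, 0 < k, 1 <= b, 0 < b & 0 < gamma + 1].
Proof. by have [] := abc; rewrite /th /k /b /theta => ? [? ?]; split; lra. Qed.

Let fy : f x @[x --> +oo] --> +oo. Proof. by have [_ [_ []]] := f1. Qed.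

Lemma near_height (X eta : R) : 0 < eta -> \forall rho \near +oo,
  [/\ 0 < rho, 0 < derive1 g (f rho) & forall w, `|w| <= M X ->
    0 < rho + w * derive1 g (f rho) /\
    `|f (rho + w * derive1 g (f rho)) - (f rho + w)| <= eta].
Proof.
move=> eta0; have H := fy (nonlinearity_expansion f1 fg f2 f4 (M X) eta0).
have r1 : \forall rho \near +oo, 1 < rho :> R by apply: nbhs_pinfty_gt; rewrite num_real.
apply: filterS2 r1 H => rho r1 /=; have r0 := lt_trans ltr01 r1.
have gr : g (f rho) = rho by apply: fg.1; exact: ltW.
rewrite gr => H; split => //.
exact: (inverse_derive1_gt0 f1 fg (A1_lt f1 ltr01 r1)).
Qed.

Lemma near_scaled_dom (X : R) : \forall rho \near +oo, forall x, x <= X ->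
  ((expR (x + log_scale alpha beta gamma g (f rho)))%:E < Rmax rho)%E.
Proof.
apply: filterS (near_height X ltr01) => rho [r0 g0 H] x.
exact: (scaled_dom f1 abc (ru r0) g0 H).
Qed.

(** This comes from u <= rho; it makes the limit z negative far to the left, which starts the
    sequence of sign changes. *)
Lemma near_scaled_height_le (x : R) : \forall rho \near +oo, Z rho x <= th * x - ys.
Proof.
apply: filterS (near_height x ltr01) => rho [r0 g0 H].
have /andP[_] := scaled_drop f1 abc (ru r0) g0 H (lexx x).
by rewrite /Z /scaled_height -/th -/b -/k -/ys; lra.
Qed.

Lemma near_scaled_height_is_derive (X : R) : \forall rho \near +oo,
  forall x : R, `|x| <= X -> is_derive x 1 (Z rho) (- th * (expR (A rho x) - 1)).
Proof.
apply: filterS (near_height X ltr01) => rho [r0 g0 H] x xX.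
apply: (scaled_height_is_derive f1 abc (ru r0) g0 H).
exact: le_trans (ler_norm _) xX.
Qed.

Let MZ X := M X + th * X + `|ys|.
Let MA X := (th * X + `|ln (gamma + 1)| + M X + 1) / b + `|ln th|.

Lemma near_scaled_bounds (X eta : R) : 0 < eta -> eta <= 1 ->
  \forall rho \near +oo, forall x, `|x| <= X ->
    [/\ `|Z rho x| <= MZ X, `|A rho x| <= MA X & exists2 e, `|e| <= eta &
      is_derive x 1 (A rho) (k / b * (expR (Z rho x - b * A rho x + e) - 1))].
Proof.
move=> eta0 eta1; apply: filterS (near_height X eta0) => rho [r0 g0 H] x xX.
have [hth hk hb1 hb hg] := pos.
have xX' : x <= X by exact: le_trans (ler_norm _) xX.
have /andP[w1 w2] := scaled_drop f1 abc (ru r0) g0 H xX'.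
have /andP[a1 a2] := scaled_log_slope_bounds f1 abc (ru r0) g0 eta1 H xX'.
have MM : drop_bound alpha beta gamma x <= M X.
  rewrite ler_pM2l ?divr_gt0// ler_expR ler_pM2r ?invr_gt0// lerD2r.
  by rewrite ler_pM2l.
have M0 : 0 <= drop_bound alpha beta gamma x.
  by rewrite mulr_ge0 ?expR_ge0// divr_ge0 ?ltW.
have tx : `|th * x| <= th * X by rewrite normrM gtr0_norm// ler_pM2l.
split; last exact: (scaled_log_slope_is_derive f1 abc (ru r0) g0 H).
- rewrite /Z /scaled_height -/th -/b -/k -/ys /MZ.
  move: tx w1 w2; set w := _ / _; rewrite !ler_norml => /andP[t1 t2] w1 w2.
  have := ler_norm ys; have := ler_norm (- ys); rewrite normrN.
  by move=> h1 h2; apply/andP; split; lra.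
- move: a1 a2; rewrite -/th -/b -/(A rho x) lerBlDr ler_pdivrMr// lerBrDr ler_pdivlMr//.
  move: tx; rewrite !ler_norml => /andP[t1 t2] a1 a2.
  have := ler_norm (ln th); have := ler_norm (- ln th); rewrite normrN.
  have := ler_norm (ln (gamma + 1)); have := ler_norm (- ln (gamma + 1)); rewrite normrN.
  move=> h1 h2 h3 h4; rewrite -/(M X) in a1.
  have c1 : (A rho x + ln th) * b <= th * X + `|ln (gamma + 1)| + M X + 1 by lra.
  have c2 : - (th * X + `|ln (gamma + 1)| + M X + 1) <= (A rho x + ln th) * b by lra.
  rewrite -ler_pdivlMr// in c1; rewrite -ler_pdivrMr// mulNr in c2.
  by rewrite /MA; apply/andP; split; lra.
Qed.

Lemma near_scaled_bounded (X : R) : exists M', \forall rho \near +oo,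
  forall x, `|x| <= X -> `|Z rho x| <= M' /\ `|A rho x| <= M'.
Proof.
exists (`|MZ X| + `|MA X|).
apply: filterS (near_scaled_bounds X ltr01 (lexx _)) => rho H x xX.
have [Zx Ax _] := H x xX; split.
  by rewrite (le_trans Zx)// (le_trans (ler_norm _))// lerDl.
by rewrite (le_trans Ax)// (le_trans (ler_norm _))// lerDr.
Qed.

Lemma near_scaled_log_slope_is_derive (X eta : R) : 0 < eta ->
  \forall rho \near +oo, forall x : R, `|x| <= X ->
    exists2 d : R, is_derive x 1 (A rho) d &
      `|d - k / b * (expR (Z rho x - b * A rho x) - 1)| <= eta.
Proof.
move=> eta0; have [hth hk hb1 hb hg] := pos.
(* Bounds the exponent with and without the error |e| <= 1, so exp is Lipschitz there with constant
   e ^ L. *)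
pose L := MZ X + b * MA X + 1.
have Q0 : 0 < k / b * expR L by rewrite mulr_gt0 ?expR_gt0 ?divr_gt0.
have e0 : 0 < Num.min 1 (eta / (k / b * expR L)).
  by rewrite lt_min ltr01 divr_gt0.
have := @near_scaled_bounds X _ e0 _; rewrite ge_min lexx => /(_ isT).
apply: filterS => rho H x xX; have [Zx Ax [e]] := H x xX.
rewrite le_min => /andP[e1 eeta] D; exists (k / b * (expR (Z rho x - b * A rho x + e) - 1)) => //.
have qL : `|Z rho x - b * A rho x| <= MZ X + b * MA X.
  by rewrite (le_trans (ler_normB _ _))// lerD// normrM gtr0_norm// ler_pM2l.
rewrite -mulrBr opprB addrA subrK normrM gtr0_norm ?divr_gt0//.
apply: (@le_trans _ _ (k / b * (expR L * `|e|))).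
  rewrite ler_pM2l ?divr_gt0//.
  have -> : `|e| = `|Z rho x - b * A rho x + e - (Z rho x - b * A rho x)|.
    by congr `|_|; ring.
  apply: expR_lipschitz; last by rewrite (le_trans qL)// lerDl.
  by rewrite (le_trans (ler_normD _ _))// lerD.
by rewrite mulrA mulrC -ler_pdivlMr.
Qed.

End scaled_family.

(** * From the limit system to solutions of large height *)

Lemma near_of_ultra {T : Type} (F : set_system T) (P : set T) : ProperFilter F ->
  (forall G, UltraFilter G -> F `<=` G -> G P) -> F P.
Proof.
move=> PF H; apply: contrapT => nFP.
(* If [P] failed, the trace of [F] on its complement would be proper, and an ultrafilter refining it
   would contain both [P] and the complement. *)
have PW : ProperFilter (within (~` P) F).
  split; last exact: within_filter.
  rewrite /within /= => W; apply: nFP.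
  by apply: filterS W => t /= h; apply: contrapT.
have [G [UG FG]] := ultraFilterLemma PW.
have GP : G P by apply: H => // B FB; apply: FG; apply: filterS FB => t Bt _.
have GnP : G (~` P) by apply: FG; rewrite /within /=; apply: filterE => t.
by have [t [Pt nPt]] := filter_ex (filterI GP GnP).
Qed.

Lemma near_forall_lt {T : Type} (F : set_system T) (P : nat -> T -> Prop) (N : nat) :
  Filter F -> (forall i, \forall t \near F, P i t) ->
  \forall t \near F, forall i, (i < N)%N -> P i t.
Proof.
move=> FF H; elim: N => [|N IH]; first exact: filterE.
apply: filterS2 IH (H N) => t h hN i; rewrite ltnS leq_eqVlt => /predU1P[->//|].
exact: h.
Qed.

Theorem theorem1p4 (R : realType) (alpha beta gamma : R) (f g : R -> R)
  (lam : R) (U : R -> R) (u : R -> R -> R) (Rmax : R -> \bar R) :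
  A1 f -> is_inverse_of g f -> A2 f g -> A3 g -> A4 g -> A5 g ->
  A6 alpha beta gamma ->
  alpha - beta - 1 < 4 * theta alpha beta gamma / (beta + 1) ->
  thm11_singular alpha beta gamma f g lam U ->
  (forall rho, 0 < rho -> regular_solution alpha beta gamma f rho (u rho) (Rmax rho)) ->
  let ustar := fun r => U (r * lam `^ (- (theta alpha beta gamma)^-1)) in
  forall delta : R, 0 < delta ->
  forall N : nat, \forall rho \near +oo,
    nzeros_ge (fun r => u rho r - ustar r)
      [set r | 0 < r < delta /\ (r%:E < Rmax rho)%E
               /\ r < lam `^ ((theta alpha beta gamma)^-1)] N.
Proof.
move=> f1 fg f2 f3 f4 _ abc disc US ru ustar delta delta0 N.
set th := theta _ _ _; set b := beta + 1 in disc *.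
set k := alpha - beta - 1 in disc.
have [th0 k0 b1] : [/\ 0 < th, 0 < k & 1 <= b].
  by have [] := abc; rewrite /th /k /b /theta => ? [? ?]; split; lra.
have b0 : 0 < b := lt_le_trans ltr01 b1.
have lam0 : 0 < lam by have [] := US.
have lamt0 : 0 < lam `^ th^-1 by rewrite powR_gt0.
have fy : f x @[x --> +oo] --> +oo by have [_ [_ []]] := f1.
pose Z rho := scaled_height alpha beta gamma f g (u rho) rho.
pose A rho := scaled_log_slope alpha beta gamma f g (u rho) rho.
pose l rho := log_scale alpha beta gamma g (f rho).
pose ys := ln (th `^ b * k).
apply: near_of_ultra => G UG FG.
have [|||z [a [Zz dz da]]] := @limit_system _ _ G th k b Z A UG th0 k0 b1.
- move=> X; have [M H] := near_scaled_bounded f1 fg f2 f4 abc ru X.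
  by exists M; exact: FG.
- by move=> X; apply: FG; exact: (near_scaled_height_is_derive f1 fg f2 f4 abc ru).
- by move=> X eta eta0; apply: FG; exact: (near_scaled_log_slope_is_derive f1 fg f2 f4 abc ru).
have disc' : b * k < 4 * th by rewrite mulrC -ltr_pdivlMr.
(* At this point the bound th x - ys equals - 1. *)
have z_neg : z ((ys - 1) / th) < 0.
  apply: (@le_lt_trans _ _ (-1)); last by rewrite oppr_lt0.
  apply: (cvgr_to_le (Zz _)); apply: FG.
  apply: filterS (near_scaled_height_le f1 fg f2 f4 abc ru ((ys - 1) / th)) => rho.
  by rewrite -/th -/b -/k -/ys -/(Z rho) [th * _]mulrC divfK ?gt_eqF//; lra.
have [|||s sP] := @sign_changes _ z ((ys - 1) / th).
- by move=> x /(z_returns_pos th0 k0 b1 disc' dz da).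
- by move=> x /(z_returns_neg th0 k0 b1 disc' dz da).
- exact: z_neg.
pose h rho r := u rho r - ustar r.
have near_r1 : \forall rho \near +oo, 1 < rho :> R.
  by apply: nbhs_pinfty_gt; rewrite num_real.
have good rho : 1 < rho -> 0 < derive1 g (f rho).
  by move=> r1; exact: (inverse_derive1_gt0 f1 fg (A1_lt f1 ltr01 r1)).
(* The rescaled difference is [Z] minus the deviation of the rescaled singular solution from its
   limit ys - th x, and that deviation tends to 0. *)
have hz i : h rho (expR (s i + l rho)) / derive1 g (f rho) @[rho --> G] --> z (s i).
  have Y : (ustar (expR (s i + l rho)) - g (f rho)) / derive1 g (f rho) @[rho --> G]
      --> ys - th * s i.
    have H := cvg_comp _ _ fy (singular_asymptotics f1 fg f2 f3 f4 abc US (x := s i)).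
    by move=> B /H; exact: FG.
  have H : Z rho (s i) - ((ustar (expR (s i + l rho)) - g (f rho)) / derive1 g (f rho)
      - (ys - th * s i)) @[rho --> G] --> z (s i) - ((ys - th * s i) - (ys - th * s i)).
    by apply: cvgB; [exact: Zz|apply: cvgB; [exact: Y|exact: cvg_cst]].
  rewrite subrr subr0 in H; apply: cvg_trans H; apply: near_eq_cvg.
  apply: FG; apply: filterS near_r1 => rho r1.
  have g0 := good _ r1; have gr : g (f rho) = rho.
    by apply: fg.1; apply: ltW; exact: lt_trans r1.
  by rewrite gr /Z /scaled_height -/(l rho) -/th -/b -/k -/ys /h; field; nz.
(* Only finitely many strict inequalities are transferred, and dividing by g' > 0 does not change
   signs. *)
have signs : \forall rho \near G, forall i, (i < N)%N ->
    h rho (expR (s i + l rho)) * h rho (expR (s i.+1 + l rho)) < 0.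
  apply: (@near_forall_lt _ G) => i; have [_ zz] := sP i.
  have H : \forall rho \near G, h rho (expR (s i + l rho)) / derive1 g (f rho) *
      (h rho (expR (s i.+1 + l rho)) / derive1 g (f rho)) < 0.
    by apply: cvgr_lt zz; apply: cvgM; exact: hz.
  apply: (@filterS2 _ G _ _ _ _ _ (FG _ near_r1) H) => rho r1; have g0 := good _ r1.
  by rewrite mulrACA -expr2 pmulr_llt0// exprn_gt0// invr_gt0.
(* The length scale shrinks to 0, so the window holding the first N sign changes enters (0, delta)
   and the domain of [ustar]. *)
have small c : \forall rho \near +oo, l rho < c.
  have ho := littleo_log_shift f1 fg f2 f4 0 b.
  have Hy : f rho + (0 - b * ln (derive1 g (f rho))) @[rho --> +oo] --> +oo.
    exact: (cvg_comp _ _ fy (littleo_shift_cvgy ho)).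
  have H : \forall rho \near +oo,
    - (th * c) < f rho + (0 - b * ln (derive1 g (f rho))) by exact: cvgry_gt Hy _.
  apply: filterS H => rho {}H.
  by rewrite /l /log_scale ltr_pdivrMr//; move: H; rewrite -/th -/b; lra.
apply: (@filterS3 _ G _ _ _ _ _ _ signs
  (FG _ (near_scaled_dom f1 fg f2 f4 abc ru (s N)))
  (FG _ (filterI near_r1
    (filterI (small (ln delta - s N)) (small (ln (lam `^ th^-1) - s N)))))).
move=> rho hs dom [r1 [ld ll]].
pose s' i := expR (s i + l rho).
have s'_lt i : s' i < s' i.+1 by rewrite ltr_expR ltrD2r; have [] := sP i.
have inD r : r <= s' N -> [/\ r < delta, (r%:E < Rmax rho)%E & r < lam `^ th^-1].
  move=> rs; split.
  - apply: (le_lt_trans rs); rewrite -[ltRHS]lnK ?posrE// ltr_expR; lra.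
  - by apply: le_lt_trans (dom _ (lexx _)); rewrite lee_fin.
  - apply: (le_lt_trans rs); rewrite -[ltRHS]lnK ?posrE// ltr_expR; lra.
have r0 : 0 < rho := lt_trans ltr01 r1.
have [|||t [ut [st tP]]] := @zeros_of_sign_changes _ (h rho) s' N.
- exact: s'_lt.
- exact: hs.
- move=> r /andP[sr rs]; have [_ rR rl] := inD r rs.
  have rp : 0 < r := lt_le_trans (expR_gt0 _) sr.
  have Du : derivable (u rho) r 1.
    by have [_ [_ [_ [sol _]]]] := ru _ r0; have [] := sol r (conj rp rR).
  have Dc : {for r, continuous (u rho)}.
    exact/differentiable_continuous/derivable1_diffP.
  have sc : 0 < r * lam `^ (- th^-1) < 1.
    rewrite mulr_gt0 ?powR_gt0//= powRN ltr_pdivrMr ?powR_gt0// mul1r//.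
  have DU : derivable U (r * lam `^ (- th^-1)) 1.
    by have [_ [sol _]] := US; have [] := sol _ sc.
  apply: continuousB => //.
  have Dm : is_derive r 1 (fun r => r * lam `^ (- th^-1))
      (r * 0 + lam `^ (- th^-1) * 1) by exact: derM (der_id r) (der_cst _ _).
  have DUr := @der_comp _ U (fun r => r * lam `^ (- th^-1)) r _ _ (DeriveDef DU erefl) Dm.
  have [Dus _] := DUr.
  exact/differentiable_continuous/derivable1_diffP.
exists t; split=> //; split=> // r rt; have [/andP[sr rs] hr] := tP r rt.
have [rd rR rl] := inD r (ltW rs).
by split=> //=; rewrite rd (lt_trans (expR_gt0 _) sr).
Qed.
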